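(* Let $w=(w_k)_{k\ge0}$ be a weight sequence with $w_0>0$, $w_k>0$ for all large $k$, and $w_{k+1}/w_k\to a<\infty$ as $k\to\infty$. Suppose that $n\to\infty$ and $m=m(n)$ with $m=\lambda n+o(\sqrt n)$, where $0<\lambda<\nu$. Let $\tau\in(0,\rho)$ satisfy $\Psi(\tau)=\lambda$, let $\pi_k=\tau^kw_k/\Phi(\tau)$, $\Pi_k=\sum_{l\ge k}\pi_l$, and $k_1(n)=\max\{k:\pi_k\ge1/n\}$, $k_2(n)=\max\{k:\Pi_k\ge1/n\}$, $k_3(n)=\max\{k:\sqrt{\Pi_k\Pi_{k+1}}\ge1/n\}$. (i) For each $j\ge1$, $Y_{(j)}=k_1(n)+O_p(1)=k_2(n)+O_p(1)=k_3(n)+O_p(1)$. (ii) If $a=0$, then moreover, with probability tending to $1$, $|Y_{(j)}-k_1(n)|\le1$, $|Y_{(j)}-k_2(n)|\le1$ and $Y_{(j)}\in\{k_3(n),k_3(n)+1\}$.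
   Context: A weight sequence is a sequence $w=(w_k)_{k\ge0}$ of nonnegative reals. $\Phi(t)=\sum_kw_kt^k$, $\rho$ its radius of convergence; $\Psi(t)=t\Phi'(t)/\Phi(t)$ for $\Phi(t)<\infty$, $\Psi(\rho)=\lim_{t\uparrow\rho}\Psi(t)$ if $\Phi(\rho)=\infty$; $\nu=\Psi(\rho)$. Balls-in-boxes: $\mathcal B_{m,n}=\{(y_1,\dots,y_n)\in\{0,1,\dots\}^n:\sum y_i=m\}$, weight $w(y)=\prod_iw_{y_i}$, $Z(m,n)=\sum_{y\in\mathcal B_{m,n}}w(y)$; when $Z(m,n)>0$, $B_{m,n}=(Y_1,\dots,Y_n)$ is random with $P(B_{m,n}=y)=w(y)/Z(m,n)$. $Y_{(1)}\ge Y_{(2)}\ge\dots$ denote $Y_1,\dots,Y_n$ in decreasing order. $X_n=k(n)+O_p(1)$ means $X_n-k(n)$ is tight. *)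

(* Defs.v *)
From Stdlib Require Import Reals Lra Lia List Arith ClassicalEpsilon.
From Stdlib Require Import Sorting.Mergesort.
From Coquelicot Require Import Coquelicot.
Import ListNotations.
Open Scope R_scope.

Definition Phi (w : nat -> R) (t : R) : R := PSeries w t.
Definition rho (w : nat -> R) : Rbar := CV_radius w.

Definition Psi (w : nat -> R) (t : R) : R := t * Derive (Phi w) t / Phi w t.

Definition upto (r : Rbar) : (R -> Prop) -> Prop :=
  match r with
  | Finite x => at_left x
  | _ => Rbar_locally r
  end.

Definition is_nu (w : nat -> R) (nu : Rbar) : Prop :=
  filterlim (Psi w) (upto (rho w)) (Rbar_locally nu).

(** Balls in boxes: B_{m,n} as the list of all y in N^n with sum m. *)
Fixpoint comps (m n : nat) : list (list nat) :=
  match n with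
  | O => if Nat.eqb m 0 then [[]] else []
  | S n' => flat_map (fun i => map (cons i) (comps (m - i) n')) (seq 0 (S m))
  end.

Definition wt (w : nat -> R) (y : list nat) : R :=
  fold_right (fun k acc => w k * acc) 1 y.

Definition Zmn (w : nat -> R) (m n : nat) : R :=
  fold_right Rplus 0 (map (wt w) (comps m n)).

Definition Prob (w : nat -> R) (m n : nat) (E : list nat -> bool) : R :=
  fold_right Rplus 0 (map (wt w) (filter E (comps m n))) / Zmn w m n.

Definition order_stat (j : nat) (y : list nat) : nat :=
  nth (j - 1) (rev (NatSort.sort y)) 0%nat.

(** The largest k with P k (defined when such a largest element exists). *)
Definition max_nat (P : nat -> Prop) : nat :=
  epsilon (inhabits 0%nat) (fun k => P k /\ forall j, P j -> (j <= k)%nat).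

Definition pik (w : nat -> R) (tau : R) (k : nat) : R := tau ^ k * w k / Phi w tau.
Definition Pik (w : nat -> R) (tau : R) (k : nat) : R :=
  Series (fun l => pik w tau (k + l)).
Definition k1 (w : nat -> R) (tau : R) (n : nat) : nat :=
  max_nat (fun k => pik w tau k >= 1 / INR n).
Definition k2 (w : nat -> R) (tau : R) (n : nat) : nat :=
  max_nat (fun k => Pik w tau k >= 1 / INR n).
Definition k3 (w : nat -> R) (tau : R) (n : nat) : nat :=
  max_nat (fun k => sqrt (Pik w tau k * Pik w tau (S k)) >= 1 / INR n).

Definition near_nat (x k c : nat) : bool := Nat.leb x (k + c) && Nat.leb k (x + c).

Definition tight_around (w : nat -> R) (m : nat -> nat) (X : list nat -> nat)
  (k : nat -> nat) : Prop :=
  forall eps, 0 < eps -> exists (C N : nat), forall n, (N <= n)%nat ->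
    Prob w (m n) n (fun y => negb (near_nat (X y) (k n) C)) <= eps.

(* Main.v *)
Require Import Defs.
From Stdlib Require Import Reals List Arith Bool.
From Coquelicot Require Import Coquelicot.
From Stdlib Require Import ZArith Lia Lra Psatz Permutation Mergesort Sorted.
From Stdlib Require Import ClassicalEpsilon.
Import ListNotations.
Open Scope R_scope.

(** Tilting turns [w] into the probability distribution [pi] with mean [lam], so the boxes are
    i.i.d. with law [pi], conditioned on their sum being [m].  Since [pi] charges three
    consecutive integers [K], [K + 1], [K + 2], a positive fraction of the boxes contains a pair
    of fair coins that is independent of everything else.  The coins give
    [P(S_n = x) <= C / sqrt n] uniformly in [x], and, with Chebyshev's inequality for the other
    boxes, [P(S_n = m) >= c / sqrt n] for [m = lam n + O(sqrt n)]; no sharper local limit theorem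
    is needed.  The upper bound also holds after multiplying [pi_l] by [z] for all [l >= k], and
    this is the conditional Chernoff bound for the number of boxes with at least [k] balls: [z = 1/2]
    shows that fewer than [j] such boxes occur with probability [O(exp (- n Pi_k / 2))], and
    [z = 1 / (n Pi_k)] that there is one with probability [O(n Pi_k)].  So [Y_(j)] is located where
    [n Pi_k] passes from large to small, which [k1], [k2] and [k3] do up to [O(1)] because
    [Pi_(k+1) / Pi_k] stays below a constant less than [1], and tends to [0] if [a = 0]. *)

(** * Finite sums and the coin walk *)

Definition lsum {A : Type} (l : list A) (f : A -> R) : R :=
  fold_right Rplus 0 (map f l).

Lemma lsum_nil {A} (f : A -> R) : lsum [] f = 0.
Proof. reflexivity. Qed.

Lemma lsum_cons {A} (x : A) l f : lsum (x :: l) f = f x + lsum l f.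
Proof. reflexivity. Qed.

Lemma lsum_app {A} (l l' : list A) f : lsum (l ++ l') f = lsum l f + lsum l' f.
Proof.
  induction l as [|x l IH]; simpl app.
  - rewrite lsum_nil; lra.
  - rewrite !lsum_cons, IH; lra.
Qed.

Lemma lsum_map {A B} (h : A -> B) l f : lsum (map h l) f = lsum l (fun x => f (h x)).
Proof. unfold lsum; now rewrite map_map. Qed.

Lemma lsum_flat_map {A B} (h : A -> list B) l f :
  lsum (flat_map h l) f = lsum l (fun x => lsum (h x) f).
Proof.
  induction l as [|x l IH]; simpl flat_map; [reflexivity|].
  now rewrite lsum_app, lsum_cons, IH.
Qed.

Lemma lsum_ext {A} (l : list A) f f' :
  (forall x, In x l -> f x = f' x) -> lsum l f = lsum l f'.
Proof.
  induction l as [|x l IH]; intros H; [reflexivity|].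
  rewrite !lsum_cons, (H x (or_introl eq_refl)), IH; [reflexivity|].
  intros y Hy; apply H; now right.
Qed.

Lemma lsum_le {A} (l : list A) f f' :
  (forall x, In x l -> f x <= f' x) -> lsum l f <= lsum l f'.
Proof.
  induction l as [|x l IH]; intros H; [apply Rle_refl|].
  rewrite !lsum_cons. apply Rplus_le_compat.
  - apply H; now left.
  - apply IH; intros y Hy; apply H; now right.
Qed.

Lemma lsum_scal {A} (l : list A) c f : lsum l (fun x => c * f x) = c * lsum l f.
Proof.
  induction l as [|x l IH]; [rewrite !lsum_nil; ring|].
  rewrite !lsum_cons, IH; ring.
Qed.

Lemma lsum_plus {A} (l : list A) f f' :
  lsum l (fun x => f x + f' x) = lsum l f + lsum l f'.
Proof.
  induction l as [|x l IH]; [rewrite !lsum_nil; ring|].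
  rewrite !lsum_cons, IH; ring.
Qed.

Lemma lsum_ge_0 {A} (l : list A) f : (forall x, In x l -> 0 <= f x) -> 0 <= lsum l f.
Proof.
  intros H. replace 0 with (lsum l (fun _ : A => 0)); [now apply lsum_le|].
  induction l as [|x l IH]; [reflexivity|].
  rewrite lsum_cons, IH; [ring|]. intros y Hy; apply H; now right.
Qed.

Lemma lsum_eq_0 {A} (l : list A) f : (forall x, In x l -> f x = 0) -> lsum l f = 0.
Proof.
  intros H; induction l as [|x l IH]; [reflexivity|].
  rewrite lsum_cons, (H x (or_introl eq_refl)), IH; [ring|].
  intros y Hy; apply H; now right.
Qed.

Lemma lsum_filter {A} (E : A -> bool) (l : list A) f :
  lsum (filter E l) f = lsum l (fun x => if E x then f x else 0).
Proof.
  induction l as [|x l IH]; [reflexivity|].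
  simpl filter. rewrite lsum_cons. destruct (E x); [rewrite lsum_cons|]; rewrite IH; lra.
Qed.

Lemma lsum_single (M k : nat) (c : R) (F : nat -> R) :
  (k < M)%nat -> lsum (seq 0 M) (fun x => (if Nat.eqb x k then c else 0) * F x) = c * F k.
Proof.
  intros H. replace M with (k + S (M - k - 1))%nat by lia.
  rewrite seq_app; simpl. rewrite lsum_app, lsum_cons, Nat.eqb_refl.
  rewrite !lsum_eq_0; [ring| |].
  - intros x Hx; apply in_seq in Hx.
    destruct (Nat.eqb_spec x k); [lia|ring].
  - intros x Hx; apply in_seq in Hx.
    destruct (Nat.eqb_spec x k); [lia|ring].
Qed.

(** Splits off the first box; [avgn_walk_conv] reproduces this recursion with the coins deferred. *)
Lemma Zmn_S w m n :
  Zmn w m (S n) = lsum (seq 0 (S m)) (fun i => w i * Zmn w (m - i) n).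
Proof.
  change (lsum (comps m (S n)) (wt w) = lsum (seq 0 (S m)) (fun i => w i * Zmn w (m - i) n)).
  change (comps m (S n)) with (flat_map (fun i => map (cons i) (comps (m - i) n)) (seq 0 (S m))).
  rewrite lsum_flat_map. apply lsum_ext; intros i _.
  rewrite lsum_map. exact (lsum_scal (comps (m - i) n) (w i) (wt w)).
Qed.

(** [walk i d] is the probability that [2 i] fair coins show [i + d] heads. *)
Fixpoint walk (i : nat) (d : Z) : R :=
  match i with
  | O => if Z.eqb d 0 then 1 else 0
  | S i' => (walk i' (d - 1) + 2 * walk i' d + walk i' (d + 1)) / 4
  end.

Lemma walk_ge_0 i d : 0 <= walk i d.
Proof.
  revert d; induction i as [|i IH]; intros d; simpl.
  - destruct (Z.eqb d 0); lra.
  - pose proof (IH (d - 1)%Z); pose proof (IH d); pose proof (IH (d + 1)%Z); lra.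
Qed.

(** In closed form [walk i d] is the binomial [C(2i, i + d) / 4^i], and this is the ratio of
    neighbouring binomial coefficients. Cleared of denominators, it holds for every integer [d],
    also where the walk vanishes. *)
Lemma walk_ratio i d :
  (INR i + IZR d + 1) * walk i (d + 1) = (INR i - IZR d) * walk i d.
Proof.
  revert d; induction i as [|i IH]; intros d.
  - simpl. destruct (Z.eqb_spec (d + 1) 0) as [H|H]; destruct (Z.eqb_spec d 0) as [H'|H'];
      try lia; try (subst; lra).
    + replace d with (-1)%Z by lia; lra.
  - rewrite S_INR; simpl walk.
    replace (d + 1 - 1)%Z with d by lia.
    pose proof (IH (d - 1)%Z) as H1; pose proof (IH d) as H2; pose proof (IH (d + 1)%Z) as H3.
    replace (d - 1 + 1)%Z with d in H1 by lia.
    rewrite minus_IZR in H1. rewrite plus_IZR in H3.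
    set (A := walk i (d - 1)) in *; set (B := walk i d) in *; set (C := walk i (d + 1)) in *;
      set (D := walk i (d + 1 + 1)) in *.
    nra.
Qed.

Lemma walk_opp i d : walk i (- d) = walk i d.
Proof.
  revert d; induction i as [|i IH]; intros d; simpl.
  - destruct (Z.eqb_spec (- d) 0); destruct (Z.eqb_spec d 0); lia || reflexivity.
  - replace (- d - 1)%Z with (- (d + 1))%Z by lia.
    replace (- d + 1)%Z with (- (d - 1))%Z by lia.
    rewrite !IH; lra.
Qed.

(** For [d >= 0] the factor [(i - d) / (i + d + 1)] from [walk_ratio] is at most 1; symmetry covers
    [d < 0]. *)
Lemma walk_le_center i d : walk i d <= walk i 0.
Proof.
  assert (H : forall k : nat, walk i (Z.of_nat k) <= walk i 0).
  { induction k as [|k IH]; [apply Rle_refl|].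
    apply Rle_trans with (2 := IH).
    pose proof (walk_ratio i (Z.of_nat k)) as H. rewrite <- INR_IZR_INZ in H.
    replace (Z.of_nat (S k)) with (Z.of_nat k + 1)%Z by lia.
    pose proof (walk_ge_0 i (Z.of_nat k)); pose proof (walk_ge_0 i (Z.of_nat k + 1)).
    pose proof (pos_INR i); pose proof (pos_INR k). nra. }
  destruct (Z.le_ge_cases 0 d) as [Hd|Hd].
  - rewrite <- (Z2Nat.id d Hd); apply H.
  - rewrite <- walk_opp, <- (Z2Nat.id (- d)); [apply H|lia].
Qed.

Lemma walk_center_S i : walk (S i) 0 = (2 * INR i + 1) / (2 * INR i + 2) * walk i 0.
Proof.
  simpl walk. pose proof (walk_ratio i 0) as H.
  replace (walk i (-1)) with (walk i 1) by (rewrite <- (walk_opp i 1); reflexivity).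
  change (0 + 1)%Z with 1%Z in H.
  pose proof (pos_INR i).
  assert (E : walk i 1 = INR i / (INR i + 1) * walk i 0).
  { apply Rmult_eq_reg_l with (INR i + 1); [|lra].
    replace (INR i + 1) with (INR i + 0 + 1) at 1 by ring. rewrite H. field; lra. }
  rewrite E. field; lra.
Qed.

(** The left side equals 1 at [i = 0] and is nonincreasing in [i], since
    [(2i + 1)(2i + 3) <= (2i + 2)^2]. *)
Lemma walk_center_upper i : (walk i 0)^2 * (2 * INR i + 1) <= 1.
Proof.
  induction i as [|i IH]; [simpl; lra|].
  rewrite walk_center_S, S_INR. pose proof (pos_INR i).
  apply Rle_trans with (2 := IH).
  replace (((2 * INR i + 1) / (2 * INR i + 2) * walk i 0) ^ 2 * (2 * (INR i + 1) + 1))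
    with ((walk i 0)^2 * (2 * INR i + 1)
          * (((2 * INR i + 1) * (2 * INR i + 3)) / (2 * INR i + 2)^2)) by (field; lra).
  rewrite <- (Rmult_1_r (walk i 0 ^ 2 * (2 * INR i + 1))) at 2.
  apply Rmult_le_compat_l; [apply Rmult_le_pos; [apply pow2_ge_0|lra]|].
  apply Rle_div_l; nra.
Qed.

(** The right side equals 1 at [i = 0] and is nondecreasing in [i]: [(2i + 1)^2 (4i + 5)] exceeds
    [(2i + 2)^2 (4i + 1)] by exactly 1. *)
Lemma walk_center_lower i : 1 <= (walk i 0)^2 * (4 * INR i + 1).
Proof.
  induction i as [|i IH]; [simpl; lra|].
  rewrite walk_center_S, S_INR. pose proof (pos_INR i).
  apply Rle_trans with (1 := IH).
  replace (((2 * INR i + 1) / (2 * INR i + 2) * walk i 0) ^ 2 * (4 * (INR i + 1) + 1))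
    with ((walk i 0)^2 * (4 * INR i + 1)
          * (((2 * INR i + 1)^2 * (4 * INR i + 5)) / ((2 * INR i + 2)^2 * (4 * INR i + 1))))
    by (field; lra).
  rewrite <- (Rmult_1_r (walk i 0 ^ 2 * (4 * INR i + 1))) at 1.
  apply Rmult_le_compat_l; [apply Rmult_le_pos; [apply pow2_ge_0|lra]|].
  apply Rle_div_r; nra.
Qed.

Lemma walk_upper i d : walk i d <= / sqrt (INR i + 1).
Proof.
  apply Rle_trans with (1 := walk_le_center i d).
  pose proof (walk_center_upper i) as H. pose proof (pos_INR i).
  pose proof (walk_ge_0 i 0).
  assert (Hs : 0 < sqrt (INR i + 1)) by (apply sqrt_lt_R0; lra).
  apply Rmult_le_reg_r with (sqrt (INR i + 1)); [assumption|].
  rewrite Rinv_l; [|lra].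
  assert (Hq : sqrt (INR i + 1) * sqrt (INR i + 1) = INR i + 1) by (apply sqrt_sqrt; lra).
  assert (0 <= walk i 0 * sqrt (INR i + 1)) by (apply Rmult_le_pos; lra).
  assert ((walk i 0 * sqrt (INR i + 1))^2 <= 1).
  { replace ((walk i 0 * sqrt (INR i + 1))^2)
      with (walk i 0 ^ 2 * (sqrt (INR i + 1) * sqrt (INR i + 1))) by ring.
    rewrite Hq. pose proof (pow2_ge_0 (walk i 0)). nra. }
  nra.
Qed.

Lemma exp_le_1_minus u : 0 <= u <= 1 / 2 -> exp (- (2 * u)) <= 1 - u.
Proof.
  intros Hu. pose proof (exp_ineq1_le (2 * u)) as H.
  rewrite exp_Ropp. pose proof (exp_pos (2 * u)).
  apply Rmult_le_reg_l with (exp (2 * u)); [assumption|].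
  rewrite Rinv_r; [nra|lra].
Qed.

(** Each step from [d] to [d + 1] costs a factor [1 - (2d + 1) / (i + d + 1)], at least
    [1 - u >= exp (- 2u)] with [u = (2d + 1) / (i + 1)]. The odd numbers [2d + 1] add up to a
    square, which gives the Gaussian exponent; the hypothesis on [d] keeps [u <= 1/2]. *)
Lemma walk_gauss i (d : nat) :
  4 * INR d <= INR i + 1 ->
  walk i 0 * exp (- (2 * (INR d)^2 / (INR i + 1))) <= walk i (Z.of_nat d).
Proof.
  pose proof (pos_INR i) as Hi.
  induction d as [|d IH]; intros H.
  - simpl. replace (- (2 * (0 * (0 * 1)) / (INR i + 1))) with 0 by (field; lra).
    rewrite exp_0; lra.
  - rewrite S_INR in *. pose proof (pos_INR d).
    specialize (IH ltac:(lra)).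
    pose proof (walk_ratio i (Z.of_nat d)) as E. rewrite <- INR_IZR_INZ in E.
    replace (Z.of_nat (S d)) with (Z.of_nat d + 1)%Z by lia.
    set (u := (2 * INR d + 1) / (INR i + 1)).
    assert (Hu : 0 <= u <= 1 / 2).
    { unfold u; split; [apply Rdiv_le_0_compat; lra|apply Rle_div_l; lra]. }
    replace (- (2 * (INR d + 1) ^ 2 / (INR i + 1)))
      with (- (2 * INR d ^ 2 / (INR i + 1)) + - (2 * u)) by (unfold u; field; lra).
    rewrite exp_plus, <- Rmult_assoc.
    apply Rle_trans with (walk i (Z.of_nat d) * (1 - u)).
    + apply Rmult_le_compat; [apply Rmult_le_pos; [apply walk_ge_0|left; apply exp_pos]
        |left; apply exp_pos|exact IH|now apply exp_le_1_minus].
    + apply Rmult_le_reg_l with (INR i + INR d + 1); [lra|]. rewrite E.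
      rewrite (Rmult_comm (walk _ _)), <- Rmult_assoc.
      apply Rmult_le_compat_r; [apply walk_ge_0|].
      assert (u * (INR i + 1) = 2 * INR d + 1) by (unfold u; field; lra).
      nra.
Qed.

Lemma walk_lower i r :
  4 * Rabs (IZR r) <= INR i + 1 ->
  exp (- (2 * (IZR r)^2 / (INR i + 1))) / sqrt (4 * INR i + 1) <= walk i r.
Proof.
  intros H.
  assert (G : forall d : nat, 4 * INR d <= INR i + 1 ->
     exp (- (2 * (INR d)^2 / (INR i + 1))) / sqrt (4 * INR i + 1) <= walk i (Z.of_nat d)).
  { intros d Hd. apply Rle_trans with (2 := walk_gauss i d Hd).
    rewrite (Rmult_comm (walk i 0)). apply Rmult_le_compat_l; [left; apply exp_pos|].
    pose proof (walk_center_lower i) as L. pose proof (pos_INR i). pose proof (walk_ge_0 i 0).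
    rewrite <- (sqrt_pow2 (walk i 0)) by assumption. rewrite <- sqrt_inv.
    apply sqrt_le_1_alt. apply Rmult_le_reg_r with (4 * INR i + 1); [lra|].
    rewrite Rinv_l; lra. }
  destruct (Z.le_ge_cases 0 r) as [Hr|Hr].
  - rewrite <- (Z2Nat.id r Hr) in *. rewrite <- INR_IZR_INZ in *. apply G.
    now rewrite Rabs_pos_eq in H by apply pos_INR.
  - rewrite <- (walk_opp i r). replace (IZR r ^ 2) with (IZR (- r) ^ 2) by (rewrite opp_IZR; ring).
    rewrite <- Rabs_Ropp, <- opp_IZR in H.
    rewrite <- (Z2Nat.id (- r)) in * by lia. rewrite <- INR_IZR_INZ in *. apply G.
    now rewrite Rabs_pos_eq in H by apply pos_INR.
Qed.

(** * Local upper bound *)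

(** Laws with infinite support enter the averages below only through their truncations to [x < M],
    whose mass may fall below 1. *)
Definition psum (p : nat -> R) (M : nat) : R := lsum (seq 0 M) p.

(** Two fair coins added to [K]. *)
Definition coin (K x : nat) : R :=
  (if Nat.eqb x K then 1/4 else 0) + (if Nat.eqb x (K + 1) then 1/2 else 0)
  + (if Nat.eqb x (K + 2) then 1/4 else 0).

Lemma lsum_coin K M (F : nat -> R) :
  (K + 3 <= M)%nat ->
  lsum (seq 0 M) (fun x => coin K x * F x)
  = F K / 4 + F (K + 1)%nat / 2 + F (K + 2)%nat / 4.
Proof.
  intros H.
  rewrite (lsum_ext _ _ (fun x => (if Nat.eqb x K then 1/4 else 0) * F x
     + ((if Nat.eqb x (K + 1) then 1/2 else 0) * F x
     + (if Nat.eqb x (K + 2) then 1/4 else 0) * F x)))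
    by (intros; unfold coin; ring).
  rewrite !lsum_plus, !lsum_single by lia. field.
Qed.

(** A box of content distributed as [p] is, with weight [al], a coin pair at [K]; in a state
    [(i, r)], [i] counts the coin boxes so far and [r] is the number of balls still to be
    placed when every coin box is counted with its mean [K + 1]. *)
Definition avg (al : R) (K M : nat) (p : nat -> R) (f : nat -> Z -> R) (i : nat) (r : Z) : R :=
  al * f (S i) (r - Z.of_nat (K + 1))%Z
  + lsum (seq 0 M) (fun x => (p x - al * coin K x) * f i (r - Z.of_nat x)%Z).

(** [avgn n f 0 r] is the mean of [f] over the state after [n] boxes, the coins being left
    unrevealed. For [f = walk] the last factor is the probability that these coins supply exactly
    what is missing. *)
Fixpoint avgn (al : R) (K M : nat) (p : nat -> R) (n : nat) (f : nat -> Z -> R) : nat -> Z -> R :=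
  match n with
  | O => f
  | S n' => avg al K M p (avgn al K M p n' f)
  end.

Section Average.

Variables (al : R) (K M : nat) (p : nat -> R).
Hypothesis al_ge_0 : 0 <= al.
Hypothesis p_ge_coin : forall x, al * coin K x <= p x.
Hypothesis M_large : (K + 3 <= M)%nat.

Notation A := (avg al K M p).
Notation An := (avgn al K M p).

Lemma avg_le f f' i r : (forall i r, f i r <= f' i r) -> A f i r <= A f' i r.
Proof.
  intros H. unfold avg. apply Rplus_le_compat.
  - now apply Rmult_le_compat_l.
  - apply lsum_le; intros x _. apply Rmult_le_compat_l; [|apply H].
    specialize (p_ge_coin x); lra.
Qed.

Lemma avg_ext f f' i r : (forall i r, f i r = f' i r) -> A f i r = A f' i r.
Proof.
  intros H. unfold avg. rewrite H. f_equal. apply lsum_ext; intros; now rewrite H.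
Qed.

Lemma avg_lin a b f f' i r :
  A (fun i r => a * f i r + b * f' i r) i r = a * A f i r + b * A f' i r.
Proof.
  unfold avg.
  rewrite (lsum_ext _ _ (fun x => a * ((p x - al * coin K x) * f i (r - Z.of_nat x)%Z)
     + b * ((p x - al * coin K x) * f' i (r - Z.of_nat x)%Z))) by (intros; ring).
  rewrite lsum_plus, !lsum_scal. ring.
Qed.

(** [coin K] has total mass 1, so a box is a coin box with mass [al] and any other box with mass
    [psum p M - al]. *)
Lemma avg_indep_r h i r :
  A (fun i _ => h i) i r = al * h (S i) + (psum p M - al) * h i.
Proof.
  unfold avg.
  rewrite (lsum_ext _ _ (fun x => h i * p x + - (al * h i) * (coin K x * 1))) by (intros; ring).
  rewrite lsum_plus, !lsum_scal, lsum_coin by assumption.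
  unfold psum. field.
Qed.

Lemma avgn_le n f f' i r : (forall i r, f i r <= f' i r) -> An n f i r <= An n f' i r.
Proof.
  intros H; revert i r; induction n as [|n IH]; intros i r; simpl; [apply H|].
  now apply avg_le.
Qed.

Lemma avgn_lin n a b f f' i r :
  An n (fun i r => a * f i r + b * f' i r) i r = a * An n f i r + b * An n f' i r.
Proof.
  revert i r; induction n as [|n IH]; intros i r; simpl; [reflexivity|].
  rewrite (avg_ext _ _ i r IH). apply avg_lin.
Qed.

Lemma avgn_const n c i r : An n (fun _ _ => c) i r = psum p M ^ n * c.
Proof.
  revert i r; induction n as [|n IH]; intros i r; simpl; [ring|].
  rewrite (avg_ext _ (fun _ _ => psum p M ^ n * c) i r IH), avg_indep_r. ring.
Qed.

(** One more coin box at the start is one more step of the walk at the end, because averaging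
    commutes with translations of [r]. *)
Lemma avgn_walk_S n i r :
  An n walk (S i) r = (An n walk i (r - 1)%Z + 2 * An n walk i r + An n walk i (r + 1)%Z) / 4.
Proof.
  revert i r; induction n as [|n IH]; intros i r; [reflexivity|].
  simpl avgn. unfold avg at 1.
  rewrite IH.
  rewrite (lsum_ext _ _ (fun x =>
     1/4 * ((p x - al * coin K x) * An n walk i (r - 1 - Z.of_nat x)%Z)
     + (1/2 * ((p x - al * coin K x) * An n walk i (r - Z.of_nat x)%Z)
     + 1/4 * ((p x - al * coin K x) * An n walk i (r + 1 - Z.of_nat x)%Z)))).
  - rewrite !lsum_plus, !lsum_scal. unfold avg.
    replace (r - Z.of_nat (K + 1) - 1)%Z with (r - 1 - Z.of_nat (K + 1))%Z by lia.
    replace (r - Z.of_nat (K + 1) + 1)%Z with (r + 1 - Z.of_nat (K + 1))%Z by lia.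
    field.
  - intros x _. rewrite IH.
    replace (r - Z.of_nat x - 1)%Z with (r - 1 - Z.of_nat x)%Z by lia.
    replace (r - Z.of_nat x + 1)%Z with (r + 1 - Z.of_nat x)%Z by lia.
    field.
Qed.

(** The coins of a box may be revealed at once or at the end: by [avgn_walk_S] the coin-box term
    equals the sum over [al * coin K x] that [avg] subtracts. The two cancel and leave plain
    convolution with [p]. *)
Lemma avgn_walk_conv n i r :
  An (S n) walk i r = lsum (seq 0 M) (fun x => p x * An n walk i (r - Z.of_nat x)%Z).
Proof.
  simpl avgn. unfold avg.
  rewrite (lsum_ext _ _ (fun x => p x * An n walk i (r - Z.of_nat x)%Z
     + - al * (coin K x * An n walk i (r - Z.of_nat x)%Z))) by (intros; ring).
  rewrite lsum_plus, lsum_scal, lsum_coin, avgn_walk_S by assumption.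
  replace (r - Z.of_nat (K + 1) - 1)%Z with (r - Z.of_nat (K + 2))%Z by lia.
  replace (r - Z.of_nat (K + 1) + 1)%Z with (r - Z.of_nat K)%Z by lia.
  field.
Qed.

(** Reconciles the sum over all [x < M] with the recursion for [Zmn], whose sum stops at [m]. *)
Lemma avgn_walk_neg n r : (r < 0)%Z -> An n walk 0 r = 0.
Proof.
  revert r; induction n as [|n IH]; intros r Hr.
  - simpl. destruct (Z.eqb_spec r 0); [lia|reflexivity].
  - rewrite avgn_walk_conv. apply lsum_eq_0; intros x _. rewrite IH; [ring|lia].
Qed.

(** Truncation at [M > m] loses nothing, since no box can hold more than [m] balls. *)
Lemma avgn_walk_Zmn n m : (m < M)%nat -> An n walk 0 (Z.of_nat m) = Zmn p m n.
Proof.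
  revert m; induction n as [|n IH]; intros m Hm.
  - destruct m as [|m]; cbn; [unfold wt; simpl; ring|reflexivity].
  - rewrite avgn_walk_conv, Zmn_S.
    replace M with (S m + (M - S m))%nat at 1 by lia.
    rewrite seq_app, lsum_app, (lsum_eq_0 (seq (0 + S m) _)).
    + rewrite Rplus_0_r. apply lsum_ext; intros x Hx. apply in_seq in Hx.
      replace (Z.of_nat m - Z.of_nat x)%Z with (Z.of_nat (m - x)) by lia.
      rewrite IH; [reflexivity|lia].
    + intros x Hx. apply in_seq in Hx. rewrite avgn_walk_neg; [ring|lia].
Qed.

(** Drift [b] and variance at most [V] per box add up over [n] boxes. The shift [c] is quantified so
    that the induction can absorb into it the drift of the other boxes; mass at most 1 keeps the
    term [n V] from growing. *)
Lemma avgn_second_moment (phi : nat -> Z -> R) (b V : R) :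
  psum p M <= 1 -> 0 <= V ->
  (forall c i r, A (fun i r => (phi i r + c)^2) i r <= (phi i r + c + b)^2 + V) ->
  forall n c i r, An n (fun i r => (phi i r + c)^2) i r <= (phi i r + c + INR n * b)^2 + INR n * V.
Proof.
  intros Hs HV H n; induction n as [|n IH]; intros c i r.
  - simpl. rewrite !Rmult_0_l, !Rplus_0_r. apply Rle_refl.
  - simpl avgn. rewrite S_INR.
    apply Rle_trans with (A (fun i r => 1 * (phi i r + (c + INR n * b))^2 + (INR n * V) * 1) i r).
    { apply avg_le; intros i' r'. rewrite Rmult_1_l, Rmult_1_r, <- Rplus_assoc. apply IH. }
    rewrite (avg_lin 1 (INR n * V) (fun i r => (phi i r + (c + INR n * b))^2) (fun _ _ => 1)).
    rewrite (avg_indep_r (fun _ => 1)).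
    specialize (H (c + INR n * b) i r).
    replace (phi i r + c + (INR n + 1) * b) with (phi i r + (c + INR n * b) + b) by ring.
    assert (INR n * V * (al * 1 + (psum p M - al) * 1) <= INR n * V).
    { pose proof (Rmult_le_pos _ _ (pos_INR n) HV). nra. }
    nra.
Qed.

(** [1 / (al n / 4 + i + 1)] is a supersolution of the recursion for the mean of
    [1 / (i + 1)]. *)
Lemma avgn_inv_upper s n i r :
  0 < al -> psum p M <= s -> s <= 2 -> al <= psum p M ->
  An n (fun i _ => / (INR i + 1)) i r <= s ^ n * / (al / 4 * INR n + INR i + 1).
Proof.
  intros Hal Hs Hs2 Hal'. revert i r; induction n as [|n IH]; intros i r.
  - simpl. rewrite Rmult_0_r, Rplus_0_l, Rmult_1_l. apply Rle_refl.
  - simpl avgn.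
    apply Rle_trans with (1 := avg_le _ _ i r IH).
    rewrite (avg_indep_r (fun i => s ^ n * / (al / 4 * INR n + INR i + 1))).
    rewrite !S_INR. simpl pow.
    pose proof (pos_INR n); pose proof (pos_INR i).
    set (y := al / 4 * INR n + INR i + 1).
    assert (Hy : 1 <= y) by (unfold y; nra).
    replace (al / 4 * INR n + (INR i + 1) + 1) with (y + 1) by (unfold y; ring).
    replace (al / 4 * (INR n + 1) + INR i + 1) with (y + al / 4) by (unfold y; field).
    assert (0 <= s ^ n) by (apply pow_le; lra).
    replace (al * (s ^ n * / (y + 1)) + (psum p M - al) * (s ^ n * / y))
      with (s ^ n * (al * / (y + 1) + (psum p M - al) * / y)) by ring.
    replace (s * s ^ n * / (y + al / 4)) with (s ^ n * (s * / (y + al / 4))) by ring.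
    apply Rmult_le_compat_l; [assumption|].
    apply Rle_trans with (al * / (y + 1) + (s - al) * / y).
    { apply Rplus_le_compat_l, Rmult_le_compat_r; [left; apply Rinv_0_lt_compat|]; lra. }
    apply Rmult_le_reg_r with (y * (y + 1) * (y + al / 4)); [nra|].
    replace ((al * / (y + 1) + (s - al) * / y) * (y * (y + 1) * (y + al / 4)))
      with ((al * y + (s - al) * (y + 1)) * (y + al / 4)) by (field; lra).
    replace (s * / (y + al / 4) * (y * (y + 1) * (y + al / 4))) with (s * y * (y + 1))
      by (field; lra).
    (* the difference of the two sides is [al (y (1 - s / 4) - (s - al) / 4)] *)
    assert (0 <= al * (y * (1 - s / 4) - (s - al) / 4)) by (apply Rmult_le_pos; nra).
    nra.
Qed.

End Average.

(** By [walk_upper], [Zmn] is at most the mean of [1 / sqrt (i + 1)], with [i] the number of coin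
    boxes. The mass bound [s] is a parameter because tilted weights will be put in. *)
Lemma Zmn_upper p al K s m n :
  0 < al -> (forall x, al * coin K x <= p x) ->
  (forall M, psum p M <= s) -> s <= 2 ->
  Zmn p m n <= s ^ n / sqrt (al / 4 * INR n + 1).
Proof.
  intros Hal Hp Hs Hs2.
  set (M := (m + K + 3)%nat).
  rewrite <- (avgn_walk_Zmn al K M p) by (unfold M; lia).
  assert (HM : (K + 3 <= M)%nat) by (unfold M; lia).
  assert (Hal' : al <= psum p M).
  { replace al with (lsum (seq 0 M) (fun x => al * (coin K x * 1))).
    - apply lsum_le; intros x _. rewrite Rmult_1_r. apply Hp.
    - rewrite lsum_scal, lsum_coin by assumption. field. }
  pose proof (pos_INR n).
  set (th := sqrt (al / 4 * INR n + 1)).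
  assert (Hth : 0 < th) by (apply sqrt_lt_R0; nra).
  assert (Hth2 : th * th = al / 4 * INR n + 1) by (apply sqrt_sqrt; nra).
  (* By AM-GM, [1 / z <= th / (2 z^2) + 1 / (2 th)] for [z = sqrt (i + 1)]. This reduces the mean of
     [1 / z] to that of [1 / (i + 1)]; [th^2] is the denominator in [avgn_inv_upper], so that both
     terms contribute equally. *)
  apply Rle_trans with (avgn al K M p n
     (fun i r => th / 2 * (fun i _ => / (INR i + 1)) i r + / (2 * th) * (fun _ _ => 1) i r) 0
     (Z.of_nat m)).
  - apply avgn_le; [lra|assumption|]. intros i r.
    apply Rle_trans with (1 := walk_upper i r).
    pose proof (pos_INR i).
    set (z := sqrt (INR i + 1)).
    assert (Hz : 0 < z) by (apply sqrt_lt_R0; lra).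
    replace (INR i + 1) with (z * z) by (apply sqrt_sqrt; lra).
    apply Rmult_le_reg_r with (2 * th * (z * z)); [repeat apply Rmult_lt_0_compat; lra|].
    replace (/ z * (2 * th * (z * z))) with (2 * th * z) by (field; lra).
    replace ((th / 2 * / (z * z) + / (2 * th) * 1) * (2 * th * (z * z)))
      with (th * th + z * z) by (field; lra).
    assert (th * th + z * z - 2 * th * z = (th - z)^2) by ring. pose proof (pow2_ge_0 (th - z)). lra.
  - rewrite (avgn_lin al K M p n (th / 2) (/ (2 * th)) (fun i _ => / (INR i + 1)) (fun _ _ => 1)).
    rewrite avgn_const by assumption.
    pose proof (avgn_inv_upper al K M p ltac:(lra) Hp HM s n 0 (Z.of_nat m) Hal (Hs M) Hs2 Hal') as H1.
    simpl INR in H1. rewrite Rplus_0_r, <- Hth2 in H1.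
    assert (H2 : psum p M ^ n <= s ^ n) by (apply pow_incr; split; [lra|apply Hs]).
    replace (s ^ n / th) with (th / 2 * (s ^ n * / (th * th)) + / (2 * th) * (s ^ n * 1))
      by (field; lra).
    apply Rplus_le_compat; apply Rmult_le_compat_l; try lra.
    left; apply Rinv_0_lt_compat; lra.
Qed.

(** * Local lower bound *)

Lemma INR_eventually_ge (x : R) : exists N, forall n, (N <= n)%nat -> x <= INR n.
Proof.
  destruct (INR_unbounded x) as [N HN]. exists N; intros n Hn.
  apply le_INR in Hn; lra.
Qed.

Lemma exp_monotone x y : x <= y -> exp x <= exp y.
Proof. intros [H|H]; [left; now apply exp_increasing|subst; apply Rle_refl]. Qed.

Lemma is_lim_seq_within (u : nat -> R) (l eps : R) :
  is_lim_seq u l -> 0 < eps -> exists N, forall n, (N <= n)%nat -> Rabs (u n - l) < eps.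
Proof.
  intros H Heps. apply is_lim_seq_spec in H. exact (H (mkposreal eps Heps)).
Qed.

(** Under the truncated law renormalised by its mass, [i] grows on average by [al / psum p M].
    Completing the square around this drift leaves a remainder of at most [al]. *)
Lemma avg_count_moment al K M p :
  (K + 3 <= M)%nat -> 0 < al -> 0 < psum p M <= 1 ->
  forall c i r, avg al K M p (fun i _ => (INR i + c)^2) i r
    <= (INR i + c + al / psum p M)^2 + al.
Proof.
  intros HM Hal Hs c i r.
  rewrite (avg_indep_r al K M p HM (fun i => (INR i + c)^2)), S_INR.
  set (s := psum p M) in *. set (y := INR i + c).
  replace (INR i + 1 + c) with (y + 1) by (unfold y; ring).
  assert (E : al * (y + 1) ^ 2 + (s - al) * y ^ 2 <= s * (y + al / s)^2 + al).
  { replace (s * (y + al / s)^2 + al)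
      with (al * (y + 1) ^ 2 + (s - al) * y ^ 2 + al * al / s) by (field; lra).
    assert (0 <= al * al / s) by (apply Rdiv_le_0_compat; nra). lra. }
  pose proof (pow2_ge_0 (y + al / s)). nra.
Qed.

(** Counting a coin box with its mean [K + 1] leaves the drift of [r] unchanged and only lowers the
    variance, so the second moment of [p] suffices as a bound. *)
Lemma avg_rest_moment al K M p V :
  (K + 3 <= M)%nat -> 0 < al -> 0 < psum p M <= 1 ->
  psum (fun x => INR x ^ 2 * p x) M <= V ->
  forall c i r, avg al K M p (fun _ r => (IZR r + c)^2) i r
    <= (IZR r + c + - (psum (fun x => INR x * p x) M / psum p M))^2 + V.
Proof.
  intros HM Hal Hs HV c i r. unfold avg.
  set (y := IZR r + c).
  rewrite (lsum_ext _ _ (fun x => y^2 * p x + (-2 * y * (INR x * p x) + (1 * (INR x^2 * p x)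
     + - al * (coin K x * (y - INR x)^2))))).
  2:{ intros x _. unfold y. rewrite minus_IZR, <- INR_IZR_INZ. ring. }
  rewrite !lsum_plus, !lsum_scal, lsum_coin by assumption.
  fold (psum p M). fold (psum (fun x => INR x * p x) M).
  fold (psum (fun x => INR x ^ 2 * p x) M).
  set (s := psum p M) in *. set (m1 := psum (fun x => INR x * p x) M) in *.
  set (m2 := psum (fun x => INR x ^ 2 * p x) M) in *.
  rewrite minus_IZR, <- INR_IZR_INZ, !plus_INR. simpl (INR 1). simpl (INR 2).
  replace (IZR r - (INR K + 1) + c) with (y - (INR K + 1)) by (unfold y; ring).
  set (k := INR K).
  assert (E : s * y^2 - 2 * y * m1 <= s * (y + - (m1 / s))^2).
  { replace (s * (y + - (m1 / s))^2) with (s * y^2 - 2 * y * m1 + m1^2 / s) by (field; lra).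
    assert (0 <= m1^2 / s) by (apply Rdiv_le_0_compat; [apply pow2_ge_0|lra]). lra. }
  pose proof (pow2_ge_0 (y + - (m1 / s))) as Hsq.
  assert (E' : s * (y + - (m1 / s))^2 <= (y + - (m1 / s))^2) by nra.
  replace (al * (y - (k + 1)) ^ 2 + (y ^ 2 * s + (-2 * y * m1 + (1 * m2 + - al *
     ((y - k) ^ 2 / 4 + (y - (k + 1)) ^ 2 / 2 + (y - (k + (1 + 1))) ^ 2 / 4)))))
    with (s * y ^ 2 - 2 * y * m1 + m2 - al / 2) by field.
  lra.
Qed.

(** A quadratic minorant, so that second moments of the state control its average. It is positive
    only if [|r| <= D sqrt n] and [|i - al n| <= al n / 2], where [walk_lower] applies; elsewhere
    [walk_ge_0] suffices. *)
Lemma walk_quadratic_lower al D :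
  0 < al <= 1 -> 0 < D ->
  exists c N, 0 < c /\ forall n, (N <= n)%nat -> forall i r,
    c / sqrt (INR n) * (1 - (IZR r)^2 / (D^2 * INR n)
       - 4 * (INR i - al * INR n)^2 / (al * INR n)^2) <= walk i r.
Proof.
  intros Hal HD.
  (* The Gaussian factor at the worst case [|r| = D sqrt n], [i = al n / 2]. The [sqrt 7] comes from
     [4 i + 1 <= 7 n] for [i <= 3/2 al n]. *)
  set (E := exp (- (4 * D^2 / al))). assert (HE : 0 < E) by apply exp_pos.
  exists (E / sqrt 7).
  assert (H7 : 0 < sqrt 7) by (apply sqrt_lt_R0; lra).
  (* Such [n] satisfy [4 D sqrt n <= al n / 2 <= i], which secures the range condition of
     [walk_lower]. *)
  destruct (INR_eventually_ge (1 + (8 * D / al)^2)) as [N HN].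
  exists N. split; [now apply Rdiv_lt_0_compat|]. intros n Hn i r.
  specialize (HN n Hn). pose proof (pow2_ge_0 (8 * D / al)).
  assert (Hn1 : 1 <= INR n) by lra.
  set (z := sqrt (INR n)).
  assert (Hz : 0 < z) by (apply sqrt_lt_R0; lra).
  assert (Hz2 : INR n = z * z) by (symmetry; apply sqrt_sqrt; lra).
  assert (HzD : 8 * D / al <= z).
  { apply Rsqr_incr_0_var; [|lra]. unfold Rsqr. rewrite <- Hz2. lra. }
  assert (HzD' : 8 * D <= al * z).
  { apply (Rmult_le_compat_l al) in HzD; [|lra].
    replace (al * (8 * D / al)) with (8 * D) in HzD by (field; lra). lra. }
  set (b := 1 - _ - _).
  assert (Hc : 0 < E / sqrt 7 / z) by (repeat apply Rdiv_lt_0_compat; assumption).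
  destruct (Rle_lt_dec b 0) as [Hb|Hb].
  { apply Rle_trans with (2 := walk_ge_0 i r). nra. }
  set (t := al * INR n) in *.
  assert (Ht : 0 < t) by (unfold t; nra).
  assert (P1 : 0 <= (IZR r)^2 / (D^2 * INR n)).
  { apply Rdiv_le_0_compat; [apply pow2_ge_0|]. apply Rmult_lt_0_compat; [apply pow_lt|]; lra. }
  assert (P2 : 0 <= 4 * (INR i - t)^2 / t^2).
  { apply Rdiv_le_0_compat; [|apply pow_lt; lra]. pose proof (pow2_ge_0 (INR i - t)); lra. }
  assert (Q1 : (IZR r)^2 <= (D * z)^2).
  { assert (A : (IZR r)^2 / (D^2 * INR n) <= 1) by (unfold b in Hb; lra).
    apply Rle_div_l in A; [|apply Rmult_lt_0_compat; [apply pow_lt|]; lra].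
    rewrite Hz2 in A. lra. }
  assert (Q2 : (2 * (INR i - t))^2 <= t^2).
  { assert (A : 4 * (INR i - t)^2 / t^2 <= 1) by (unfold b in Hb; lra).
    apply Rle_div_l in A; [|apply pow_lt; lra]. lra. }
  assert (R1 : Rabs (IZR r) <= D * z).
  { rewrite <- (Rabs_pos_eq (D * z)) by nra. apply Rsqr_le_abs_0. rewrite !Rsqr_pow2. exact Q1. }
  assert (R2 : t / 2 <= INR i <= 3 / 2 * t).
  { assert (A : Rabs (2 * (INR i - t)) <= t).
    { rewrite <- (Rabs_pos_eq t) at 2 by lra. apply Rsqr_le_abs_0. rewrite !Rsqr_pow2. exact Q2. }
    apply Rabs_le_between in A. lra. }
  assert (Ht2 : t = al * z * z) by (unfold t; rewrite Hz2; ring).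
  assert (R3 : 8 * (D * z) <= t) by (rewrite Ht2; nra).
  apply Rle_trans with (2 := walk_lower i r ltac:(lra)).
  apply Rle_trans with (E / sqrt 7 / z).
  { rewrite <- (Rmult_1_r (E / sqrt 7 / z)) at 2. apply Rmult_le_compat_l; [lra|].
    unfold b; lra. }
  pose proof (pos_INR i).
  apply Rle_trans with (E / sqrt (4 * INR i + 1)).
  - unfold Rdiv. rewrite Rmult_assoc. apply Rmult_le_compat_l; [lra|].
    rewrite <- Rinv_mult. apply Rinv_le_contravar; [apply sqrt_lt_R0; lra|].
    unfold z. rewrite <- sqrt_mult by lra. apply sqrt_le_1_alt.
    assert (t <= INR n) by (unfold t; nra). lra.
  - apply Rmult_le_compat_r; [left; apply Rinv_0_lt_compat, sqrt_lt_R0; lra|].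
    unfold E. apply exp_monotone, Ropp_le_contravar.
    apply Rle_div_l; [lra|].
    assert (A : 4 * D ^ 2 / al * (t / 2) = 2 * (D * z)^2) by (rewrite Ht2; field; lra).
    assert (0 <= 4 * D^2 / al) by (apply Rdiv_le_0_compat; [pose proof (pow2_ge_0 D)|]; lra).
    nra.
Qed.

(** Chebyshev's inequality with deferred coins: the quadratic minorant of the walk is averaged using
    the second moments of [i] and of [r]. *)
Lemma Zmn_lower p al K (lam V : R) (m : nat -> nat) :
  0 < al <= 1 -> (forall x, al * coin K x <= p x) ->
  (forall M, psum p M <= 1) -> is_lim_seq (psum p) 1 ->
  is_lim_seq (psum (fun x => INR x * p x)) lam ->
  0 <= V -> (forall M, psum (fun x => INR x ^ 2 * p x) M <= V) ->
  (exists N, forall n, (N <= n)%nat -> Rabs (INR (m n) - lam * INR n) <= sqrt (INR n)) ->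
  exists c N, 0 < c /\ forall n, (N <= n)%nat -> c / sqrt (INR n) <= Zmn p (m n) n.
Proof.
  intros Hal Hp Hs Hlim Hmean HV0 HV [N0 Hm].
  (* With this [D] the deviation of [r] costs at most 1/4, and [n >= 64 / al^2] makes that of [i]
     cost at most 1/8. Of a mass of at least 3/4, more than 1/4 remains. *)
  set (D := sqrt (4 * (4 + V))).
  assert (HD : 0 < D) by (apply sqrt_lt_R0; lra).
  assert (HD2 : D ^ 2 = 4 * (4 + V)) by (apply pow2_sqrt; lra).
  destruct (walk_quadratic_lower al D Hal HD) as (c & N1 & Hc & HN1).
  destruct (INR_eventually_ge (1 + 64 / al^2)) as [N2 HN2].
  exists (c / 4), (N0 + N1 + N2)%nat. split; [lra|]. intros n Hn.
  specialize (Hm n ltac:(lia)). specialize (HN1 n ltac:(lia)). specialize (HN2 n ltac:(lia)).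
  assert (Hal2 : 0 < al^2) by (apply pow_lt; lra).
  assert (0 < 64 / al^2) by (apply Rdiv_lt_0_compat; lra).
  assert (Hn1 : 1 <= INR n) by lra.
  set (z := sqrt (INR n)) in *.
  assert (Hz2 : z ^ 2 = INR n) by (apply pow2_sqrt; lra).
  assert (Hz : 1 <= z) by (rewrite <- sqrt_1; apply sqrt_le_1_alt; lra).
  (* the truncation level is chosen after [n], so that truncating is harmless *)
  destruct (is_lim_seq_within (fun M => psum p M ^ n) (1 ^ n) (1/4)) as [M1 HM1];
    [|lra|].
  { apply (is_lim_seq_continuous (fun x => x ^ n)); [|exact Hlim].
    apply derivable_continuous_pt, derivable_pt_pow. }
  assert (Hinv : is_lim_seq (fun M => / psum p M) (/ 1)).
  { apply (is_lim_seq_inv _ 1 Hlim). intros E; injection E; lra. }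
  (* The precision [/ INR n] keeps the drift error summed over [n] boxes below 1. *)
  destruct (is_lim_seq_within (fun M => psum (fun x => INR x * p x) M / psum p M)
     (lam * / 1) (/ INR n)) as [M2 HM2]; [|apply Rinv_0_lt_compat; lra|].
  { exact (is_lim_seq_mult' _ _ lam (/ 1) Hmean Hinv). }
  destruct (is_lim_seq_within _ _ (/ INR n) Hinv) as [M3 HM3]; [apply Rinv_0_lt_compat; lra|].
  destruct (is_lim_seq_within _ _ (1/2) Hlim) as [M4 HM4]; [lra|].
  set (M := (K + 3 + m n + 1 + M1 + M2 + M3 + M4)%nat).
  specialize (HM1 M ltac:(unfold M; lia)). specialize (HM2 M ltac:(unfold M; lia)).
  specialize (HM3 M ltac:(unfold M; lia)). specialize (HM4 M ltac:(unfold M; lia)).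
  assert (HKM : (K + 3 <= M)%nat) by (unfold M; lia).
  rewrite <- (avgn_walk_Zmn al K M p HKM) by (unfold M; lia).
  set (s := psum p M) in *. set (mu := psum (fun x => INR x * p x) M / s) in *.
  assert (Hs1 : 0 < s <= 1).
  { split; [|apply Hs]. apply Rabs_lt_between in HM4. lra. }
  rewrite pow1 in HM1. apply Rabs_lt_between in HM1. rewrite Rinv_1 in HM2, HM3.
  rewrite Rmult_1_r in HM2.
  pose proof (avgn_second_moment al K M p ltac:(lra) Hp HKM (fun i _ => INR i) _ al (Hs M)
    ltac:(lra) (avg_count_moment al K M p HKM ltac:(lra) Hs1)
    n (- (al * INR n)) 0 (Z.of_nat (m n))) as Hcount.
  pose proof (avgn_second_moment al K M p ltac:(lra) Hp HKM (fun _ r => IZR r) _ V (Hs M)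
    ltac:(lra) (avg_rest_moment al K M p V HKM ltac:(lra) Hs1 (HV M))
    n 0 0 (Z.of_nat (m n))) as Hrest.
  fold s in Hcount, Hrest. fold mu in Hrest. cbv beta in Hcount, Hrest.
  change (INR 0) with 0 in Hcount.
  rewrite <- INR_IZR_INZ in Hrest.
  set (W1 := avgn al K M p n (fun i _ => (INR i + - (al * INR n))^2) 0 (Z.of_nat (m n))) in *.
  set (W2 := avgn al K M p n (fun _ r => (IZR r + 0)^2) 0 (Z.of_nat (m n))) in *.
  assert (HW1 : W1 <= 2 * INR n).
  { apply Rle_trans with (1 := Hcount).
    set (e := INR n * (/ s - 1)).
    assert (He : Rabs e <= 1).
    { unfold e. rewrite Rabs_mult, Rabs_pos_eq by lra.
      apply Rmult_le_reg_l with (/ INR n); [apply Rinv_0_lt_compat; lra|].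
      rewrite <- Rmult_assoc, Rinv_l, Rmult_1_l, Rmult_1_r by lra. lra. }
    replace (0 + - (al * INR n) + INR n * (al / s)) with (al * e) by (unfold e; field; lra).
    apply Rabs_le_between in He. assert (-1 <= al * e <= 1) by (split; nra).
    assert ((al * e)^2 <= 1) by nra.
    pose proof (Rmult_le_compat_l (INR n) al 1 ltac:(lra) ltac:(lra)). lra. }
  assert (HW2 : W2 <= (4 + V) * INR n).
  { apply Rle_trans with (1 := Hrest).
    set (e := INR n * (lam - mu)).
    assert (He : Rabs e <= 1).
    { unfold e. rewrite Rabs_mult, Rabs_pos_eq by lra.
      apply Rmult_le_reg_l with (/ INR n); [apply Rinv_0_lt_compat; lra|].
      rewrite <- Rmult_assoc, Rinv_l, Rmult_1_l, Rmult_1_r by lra.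
      rewrite Rabs_minus_sym. lra. }
    replace (INR (m n) + 0 + INR n * - mu) with (INR (m n) - lam * INR n + e) by (unfold e; ring).
    apply Rabs_le_between in He. apply Rabs_le_between in Hm.
    assert ((INR (m n) - lam * INR n + e)^2 <= (2 * z)^2).
    { apply pow_maj_Rabs. apply Rabs_le_between. lra. }
    nra. }
  set (a2 := / (D^2 * INR n)). set (a1 := 4 / (al * INR n)^2).
  assert (Ha2 : 0 <= a2) by (left; apply Rinv_0_lt_compat; rewrite HD2; nra).
  assert (Ha1 : 0 <= a1) by (left; apply Rdiv_lt_0_compat; [lra|apply pow_lt; nra]).
  (* The minorant as nested linear combinations of two functions, the shape that [avgn_lin]
     splits. *)
  apply Rle_trans with (avgn al K M p n (fun i r =>
    c / z * (fun i r => 1 * (fun i r => 1 * (fun _ _ => 1) i r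
         + - a2 * (fun _ r => (IZR r + 0)^2) i r) i r
         + - a1 * (fun i _ => (INR i + - (al * INR n))^2) i r) i r + 0 * (fun _ _ => 0) i r)
    0 (Z.of_nat (m n))).
  - rewrite (avgn_lin al K M p n (c / z) 0 (fun i r => 1 * (fun i r => 1 * (fun _ _ => 1) i r
         + - a2 * (fun _ r => (IZR r + 0)^2) i r) i r
         + - a1 * (fun i _ => (INR i + - (al * INR n))^2) i r) (fun _ _ => 0)).
    rewrite (avgn_lin al K M p n 1 (- a1) (fun i r => 1 * (fun _ _ => 1) i r
         + - a2 * (fun _ r => (IZR r + 0)^2) i r) (fun i _ => (INR i + - (al * INR n))^2)).
    rewrite (avgn_lin al K M p n 1 (- a2) (fun _ _ => 1) (fun _ r => (IZR r + 0)^2)).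
    rewrite avgn_const by assumption. fold W1 W2 s.
    assert (B1 : a1 * W1 <= 1 / 8).
    { apply Rle_trans with (a1 * (2 * INR n)); [now apply Rmult_le_compat_l|].
      replace (a1 * (2 * INR n)) with (64 / al^2 / INR n * (1/8)) by (unfold a1; field; lra).
      assert (64 / al^2 / INR n <= 1) by (apply Rle_div_l; lra). lra. }
    assert (B2 : a2 * W2 <= 1 / 4).
    { apply Rle_trans with (a2 * ((4 + V) * INR n)); [now apply Rmult_le_compat_l|].
      unfold a2. rewrite HD2. right. field; lra. }
    assert (0 < c / z) by (apply Rdiv_lt_0_compat; lra).
    replace (c / 4 / z) with (c / z * (1/4)) by (field; lra).
    nra.
  - apply avgn_le; [lra|exact Hp|]. intros i r.
    apply Rle_trans with (2 := HN1 i r). right.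
    unfold a1, a2. field. repeat split; lra.
Qed.

(** * Conditional Chernoff bounds *)

Lemma psum_S p M : psum p (S M) = psum p M + p M.
Proof. unfold psum. rewrite seq_S, lsum_app, lsum_cons, lsum_nil. simpl. ring. Qed.

Lemma psum_add p k M : psum p (k + M) = psum p k + psum (fun l => p (k + l)%nat) M.
Proof.
  induction M as [|M IH]; [rewrite Nat.add_0_r; unfold psum; simpl; rewrite lsum_nil; ring|].
  rewrite Nat.add_succ_r, !psum_S, IH. ring.
Qed.

Lemma psum_incr p M M' : (forall k, 0 <= p k) -> (M <= M')%nat -> psum p M <= psum p M'.
Proof.
  intros Hp H. induction H as [|M' _ IH]; [apply Rle_refl|].
  rewrite psum_S. specialize (Hp M'). lra.
Qed.

Lemma is_lim_seq_psum p (l : R) : is_series p l -> is_lim_seq (psum p) l.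
Proof.
  intros H. apply is_lim_seq_incr_1. apply is_lim_seq_ext with (sum_n p); [|exact H].
  intros M; induction M as [|M IH].
  - rewrite sum_O. unfold psum, lsum. simpl. now rewrite Rplus_0_r.
  - rewrite sum_Sn, psum_S, <- IH. reflexivity.
Qed.

Lemma psum_le_series p (l : R) M : (forall k, 0 <= p k) -> is_series p l -> psum p M <= l.
Proof.
  intros Hp H. apply is_lim_seq_incr_compare with (u := psum p).
  - now apply is_lim_seq_psum.
  - intros n; rewrite psum_S. specialize (Hp n). lra.
Qed.

(** Convertible to [Pik w tau k] when [p] is [pik w tau]. *)
Definition tail_sum (p : nat -> R) (k : nat) : R := Series (fun l => p (k + l)%nat).

Section Tail.

Variables (p : nat -> R).
Hypothesis p_ge_0 : forall k, 0 <= p k.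
Hypothesis p_sum : is_series p 1.

Lemma is_series_tail k : is_series (fun l => p (k + l)%nat) (tail_sum p k).
Proof.
  apply Series_correct. apply (ex_series_incr_n p k). now exists 1.
Qed.

Lemma psum_tail k : psum p k + tail_sum p k = 1.
Proof.
  assert (H : is_lim_seq (fun M => psum p (k + M)%nat) (psum p k + tail_sum p k)).
  { apply is_lim_seq_ext with (fun M => psum p k + psum (fun l => p (k + l)%nat) M).
    - intros M; now rewrite psum_add.
    - apply is_lim_seq_plus'; [apply is_lim_seq_const|].
      apply is_lim_seq_psum, is_series_tail. }
  assert (H' : is_lim_seq (fun M => psum p (k + M)%nat) 1).
  { apply is_lim_seq_ext with (fun M => psum p (M + k)%nat).
    - intros M; now rewrite Nat.add_comm.
    - apply -> is_lim_seq_incr_n. now apply is_lim_seq_psum. }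
  apply is_lim_seq_unique in H. apply is_lim_seq_unique in H'. congruence.
Qed.

Lemma tail_sum_S k : tail_sum p k = p k + tail_sum p (S k).
Proof. pose proof (psum_tail k); pose proof (psum_tail (S k)). rewrite psum_S in *. lra. Qed.

Lemma tail_sum_ge_0 k : 0 <= tail_sum p k.
Proof.
  pose proof (psum_le_series p 1 k p_ge_0 p_sum). pose proof (psum_tail k). lra.
Qed.

Lemma tail_sum_le_1 k : tail_sum p k <= 1.
Proof.
  pose proof (psum_tail k). pose proof (psum_incr p 0 k p_ge_0 (Nat.le_0_l k)) as H0.
  unfold psum at 1 in H0. simpl in H0. rewrite lsum_nil in H0. lra.
Qed.

Lemma tail_sum_lim_0 : is_lim_seq (tail_sum p) 0.
Proof.
  apply is_lim_seq_ext with (fun k => 1 - psum p k).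
  - intros k; pose proof (psum_tail k); lra.
  - replace 0 with (1 - 1) by ring. apply is_lim_seq_minus'; [apply is_lim_seq_const|].
    now apply is_lim_seq_psum.
Qed.

(** The quotient of [Zmn (tilt k z)] by [Zmn p] is the conditional generating function, at [z], of
    the number of boxes with at least [k] balls. *)
Definition tilt (k : nat) (z : R) (l : nat) : R := if Nat.leb k l then z * p l else p l.

Lemma psum_tilt k z M : 0 <= z -> psum (tilt k z) M <= 1 + (z - 1) * tail_sum p k.
Proof.
  intros Hz.
  assert (Hn : forall l, 0 <= tilt k z l).
  { intros l; unfold tilt; destruct (Nat.leb k l); [apply Rmult_le_pos|]; auto. }
  apply Rle_trans with (psum (tilt k z) (k + M)); [apply psum_incr; auto; lia|].
  rewrite psum_add.
  replace (psum (tilt k z) k) with (psum p k).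
  2:{ apply lsum_ext; intros l Hl; apply in_seq in Hl. unfold tilt.
      destruct (Nat.leb_spec k l); [lia|reflexivity]. }
  replace (psum (fun l => tilt k z (k + l)) M) with (z * psum (fun l => p (k + l)%nat) M).
  2:{ unfold psum. rewrite <- lsum_scal. apply lsum_ext; intros l _. unfold tilt.
      destruct (Nat.leb_spec k (k + l)); [reflexivity|lia]. }
  pose proof (psum_tail k).
  pose proof (psum_le_series (fun l => p (k + l)%nat) (tail_sum p k) M (fun l => p_ge_0 (k + l)) (is_series_tail k)).
  nra.
Qed.

Definition count_ge (k : nat) (y : list nat) : nat := length (filter (Nat.leb k) y).

Lemma wt_tilt k z y : wt (tilt k z) y = z ^ count_ge k y * wt p y.
Proof.
  induction y as [|l y IH]; [unfold count_ge, wt; simpl; ring|].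
  change (tilt k z l * wt (tilt k z) y = z ^ count_ge k (l :: y) * (p l * wt p y)).
  rewrite IH. unfold count_ge, tilt; simpl.
  destruct (Nat.leb k l); simpl; ring.
Qed.

Lemma wt_ge_0 y : 0 <= wt p y.
Proof.
  induction y as [|l y IH]; [unfold wt; simpl; lra|].
  now apply (Rmult_le_pos (p l) (wt p y)).
Qed.

Lemma Prob_lsum m n E :
  Prob p m n E = lsum (comps m n) (fun y => if E y then wt p y else 0) / Zmn p m n.
Proof. unfold Prob. f_equal. exact (lsum_filter E (comps m n) (wt p)). Qed.

(** Markov's inequality for [z ^ count_ge k y] under the conditioned law. *)
Lemma Prob_tilt_le m n (E : list nat -> bool) k z c :
  0 <= z -> 0 < c -> 0 < Zmn p m n ->
  (forall y, E y = true -> c <= z ^ count_ge k y) ->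
  Prob p m n E <= Zmn (tilt k z) m n / (c * Zmn p m n).
Proof.
  intros Hz Hc HZ HE. rewrite Prob_lsum.
  replace (Zmn (tilt k z) m n / (c * Zmn p m n))
    with (/ c * Zmn (tilt k z) m n / Zmn p m n) by (field; lra).
  apply Rmult_le_compat_r; [left; now apply Rinv_0_lt_compat|].
  change (Zmn (tilt k z) m n) with (lsum (comps m n) (wt (tilt k z))).
  rewrite <- lsum_scal. apply lsum_le; intros y _. rewrite wt_tilt.
  pose proof (wt_ge_0 y).
  destruct (E y) eqn:Ey.
  - apply Rmult_le_reg_l with c; [assumption|].
    replace (c * (/ c * (z ^ count_ge k y * wt p y))) with (z ^ count_ge k y * wt p y)
      by (field; lra).
    apply Rmult_le_compat_r; auto.
  - apply Rmult_le_pos; [left; now apply Rinv_0_lt_compat|].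
    apply Rmult_le_pos; [now apply pow_le|assumption].
Qed.

Lemma pow_le_exp x n : 0 <= 1 + x -> (1 + x) ^ n <= exp (INR n * x).
Proof.
  intros Hx. induction n as [|n IH]; [rewrite Rmult_0_l, exp_0; apply Rle_refl|].
  rewrite S_INR. replace ((INR n + 1) * x) with (x + INR n * x) by ring.
  rewrite exp_plus. simpl. apply Rmult_le_compat; auto using pow_le, exp_ineq1_le.
Qed.

Variables (al : R) (K : nat).
Hypothesis al_pos : 0 < al.
Hypothesis p_ge_coin : forall x, al * coin K x <= p x.

(** The tilt acts only beyond the three coin points, so the coins survive it and [Zmn_upper] applies
    to the tilted weights. *)
Lemma tilt_ge_coin k z x : (K + 3 <= k)%nat -> 0 <= z -> al * coin K x <= tilt k z x.
Proof.
  intros Hk Hz. unfold tilt. destruct (Nat.leb_spec k x) as [H|H]; [|apply p_ge_coin].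
  unfold coin.
  destruct (Nat.eqb_spec x K); [lia|]. destruct (Nat.eqb_spec x (K + 1)); [lia|].
  destruct (Nat.eqb_spec x (K + 2)); [lia|].
  pose proof (Rmult_le_pos _ _ Hz (p_ge_0 x)). lra.
Qed.

(** Here [1 + x] bounds the tilted mass and must stay below the limit 2 of [Zmn_upper];
    [2 / sqrt al] comes from [al n / 4 + 1 >= al n / 4]. *)
Lemma Zmn_tilt_le k z x m n :
  (K + 3 <= k)%nat -> (1 <= n)%nat -> 0 <= z ->
  (z - 1) * tail_sum p k <= x -> 0 <= 1 + x <= 2 ->
  Zmn (tilt k z) m n <= exp (INR n * x) * (2 / sqrt al) / sqrt (INR n).
Proof.
  intros Hk Hn Hz Hx Hx2. apply le_INR in Hn. simpl in Hn.
  apply Rle_trans with ((1 + x) ^ n / sqrt (al / 4 * INR n + 1)).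
  - apply (Zmn_upper _ al K); [assumption| | |lra].
    + intros; now apply tilt_ge_coin.
    + intros M. pose proof (psum_tilt k z M Hz). lra.
  - assert (Hsa : 0 < sqrt al) by now apply sqrt_lt_R0.
    assert (Hsn : 0 < sqrt (INR n)) by (apply sqrt_lt_R0; lra).
    replace (exp (INR n * x) * (2 / sqrt al) / sqrt (INR n))
      with (exp (INR n * x) * / (sqrt al * sqrt (INR n) / 2)) by (field; lra).
    apply Rmult_le_compat; [apply pow_le; lra|left; apply Rinv_0_lt_compat, sqrt_lt_R0; nra
       |apply pow_le_exp; lra|].
    apply Rinv_le_contravar; [nra|].
    rewrite <- sqrt_mult by lra.
    replace (sqrt (al * INR n) / 2) with (sqrt (al * INR n / (2 * 2))).
    + apply sqrt_le_1_alt. lra.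
    + rewrite sqrt_div_alt by lra. rewrite sqrt_square by lra. reflexivity.
Qed.

Variables (c : R) (m n : nat).
Hypothesis c_pos : 0 < c.
Hypothesis n_pos : (1 <= n)%nat.
Hypothesis Z_lower : c / sqrt (INR n) <= Zmn p m n.

Lemma Z_pos : 0 < Zmn p m n.
Proof.
  apply Rlt_le_trans with (2 := Z_lower). apply Rdiv_lt_0_compat; [assumption|].
  apply sqrt_lt_R0. apply lt_0_INR; lia.
Qed.

(** The factor [1 / sqrt n] in the upper bound for the tilted weights cancels the one in the lower
    bound for [Zmn p m n]: conditioning on the sum costs only a constant. *)
Lemma Prob_chernoff (E : list nat -> bool) k z b x :
  (K + 3 <= k)%nat -> 0 <= z -> 0 < b ->
  (forall y, E y = true -> b <= z ^ count_ge k y) ->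
  (z - 1) * tail_sum p k <= x -> 0 <= 1 + x <= 2 ->
  Prob p m n E <= 2 / sqrt al / c * (exp (INR n * x) / b).
Proof.
  intros Hk Hz Hb HE Hx Hx2.
  assert (Hn : 0 < sqrt (INR n)) by (apply sqrt_lt_R0, lt_0_INR; lia).
  assert (Hsa : 0 < sqrt al) by now apply sqrt_lt_R0.
  apply Rle_trans with (1 := Prob_tilt_le m n E k z b Hz Hb Z_pos HE).
  replace (2 / sqrt al / c * (exp (INR n * x) / b))
    with (exp (INR n * x) * (2 / sqrt al) / sqrt (INR n) * / (b * (c / sqrt (INR n))))
    by (field; lra).
  pose proof (Zmn_tilt_le k z x m n Hk n_pos Hz Hx Hx2) as H.
  assert (Hcn : 0 < c / sqrt (INR n)) by now apply Rdiv_lt_0_compat.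
  apply Rle_trans with (exp (INR n * x) * (2 / sqrt al) / sqrt (INR n) * / (b * Zmn p m n)).
  - apply Rmult_le_compat_r; [|assumption].
    left. apply Rinv_0_lt_compat, Rmult_lt_0_compat; [assumption|apply Z_pos].
  - apply Rmult_le_compat_l.
    + pose proof (exp_pos (INR n * x)).
      left. repeat apply Rmult_lt_0_compat; try apply Rinv_0_lt_compat; lra.
    + apply Rinv_le_contravar; [now apply Rmult_lt_0_compat|].
      apply Rmult_le_compat_l; lra.
Qed.

(** Take [z = 1/2]: fewer than [j] factors keep the power above [2^(-j)], while the mass drops to
    [1 - tail_sum p k / 2]. *)
Lemma Prob_count_lt (E : list nat -> bool) k j :
  (K + 3 <= k)%nat -> (forall y, E y = true -> (count_ge k y < j)%nat) ->
  Prob p m n E <= 2 / sqrt al / c * 2 ^ j * exp (- (INR n * tail_sum p k / 2)).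
Proof.
  intros Hk HE. pose proof (tail_sum_ge_0 k). pose proof (tail_sum_le_1 k).
  assert (H2 : forall i, 0 < 2 ^ i) by (intros; apply pow_lt; lra).
  apply Rle_trans with (2 / sqrt al / c * (exp (INR n * (- (tail_sum p k / 2))) / / 2 ^ j)).
  - apply (Prob_chernoff E k (/ 2)); try lra; auto.
    + now apply Rinv_0_lt_compat.
    + intros y Hy. specialize (HE y Hy). rewrite pow_inv.
      apply Rinv_le_contravar; [auto|]. apply Rle_pow; [lra|lia].
  - right. replace (INR n * - (tail_sum p k / 2)) with (- (INR n * tail_sum p k / 2)) by field.
    unfold Rdiv. rewrite Rinv_inv. ring.
Qed.

(** Take [z = 1 / u] with [u = n * tail_sum p k]: a single box makes the power at least [1 / u], and
    the tilted mass is at most [1 + 1 / n], whose [n]-th power is at most [exp 1]. *)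
Lemma Prob_count_ge_1 (E : list nat -> bool) k :
  (K + 3 <= k)%nat -> (forall y, E y = true -> (1 <= count_ge k y)%nat) ->
  0 < tail_sum p k -> INR n * tail_sum p k <= 1 ->
  Prob p m n E <= 2 / sqrt al / c * exp 1 * (INR n * tail_sum p k).
Proof.
  intros Hk HE Ht Hnt.
  assert (Hn : 1 <= INR n) by now apply (le_INR 1).
  set (u := INR n * tail_sum p k) in *.
  assert (Hu : 0 < u) by (apply Rmult_lt_0_compat; lra).
  assert (Hu1 : 1 <= / u) by (rewrite <- Rinv_1; apply Rinv_le_contravar; lra).
  assert (Hn' : 0 < / INR n <= 1).
  { split; [apply Rinv_0_lt_compat; lra|]. rewrite <- Rinv_1. apply Rinv_le_contravar; lra. }
  apply Rle_trans with (2 / sqrt al / c * (exp (INR n * / INR n) / / u)).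
  - apply (Prob_chernoff E k (/ u)); try lra; auto.
    + intros y Hy. specialize (HE y Hy).
      rewrite <- (pow_1 (/ u)) at 1. now apply Rle_pow.
    + replace (/ INR n) with (/ u * tail_sum p k) by (unfold u; field; lra). lra.
  - right. rewrite Rinv_r by lra. unfold Rdiv. rewrite Rinv_inv. ring.
Qed.

End Tail.

Section Measure.

Variables (p : nat -> R) (m n : nat).
Hypothesis p_ge_0 : forall k, 0 <= p k.
Hypothesis Z_gt_0 : 0 < Zmn p m n.

Lemma Prob_le_impl (E E' : list nat -> bool) :
  (forall y, E y = true -> E' y = true) -> Prob p m n E <= Prob p m n E'.
Proof.
  intros H. rewrite !Prob_lsum.
  apply Rmult_le_compat_r; [left; apply Rinv_0_lt_compat, Z_gt_0|].
  apply lsum_le; intros y _. specialize (H y). pose proof (wt_ge_0 p p_ge_0 y).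
  destruct (E y); [now rewrite H|]. destruct (E' y); lra.
Qed.

Lemma Prob_orb (E E' : list nat -> bool) :
  Prob p m n (fun y => E y || E' y) <= Prob p m n E + Prob p m n E'.
Proof.
  rewrite !Prob_lsum. unfold Rdiv. rewrite <- Rmult_plus_distr_r.
  apply Rmult_le_compat_r; [left; apply Rinv_0_lt_compat, Z_gt_0|].
  rewrite <- lsum_plus. apply lsum_le; intros y _. pose proof (wt_ge_0 p p_ge_0 y).
  destruct (E y), (E' y); simpl; lra.
Qed.

Lemma Prob_negb (E : list nat -> bool) :
  Prob p m n E = 1 - Prob p m n (fun y => negb (E y)).
Proof.
  rewrite !Prob_lsum. pose proof Z_gt_0 as HZ.
  apply Rmult_eq_reg_r with (Zmn p m n); [|lra].
  replace ((1 - lsum (comps m n) (fun y => if negb (E y) then wt p y else 0) / Zmn p m n)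
    * Zmn p m n) with (Zmn p m n - lsum (comps m n) (fun y => if negb (E y) then wt p y else 0))
    by (field; lra).
  replace (lsum (comps m n) (fun y => if E y then wt p y else 0) / Zmn p m n * Zmn p m n)
    with (lsum (comps m n) (fun y => if E y then wt p y else 0)) by (field; lra).
  change (Zmn p m n) with (lsum (comps m n) (wt p)).
  apply Rplus_eq_reg_r with (lsum (comps m n) (fun y => if negb (E y) then wt p y else 0)).
  rewrite <- lsum_plus.
  replace (lsum (comps m n) (wt p) - lsum (comps m n) (fun y => if negb (E y) then wt p y else 0) +
    lsum (comps m n) (fun y => if negb (E y) then wt p y else 0)) with (lsum (comps m n) (wt p))
    by ring.
  apply lsum_ext; intros y _. destruct (E y); simpl; ring.
Qed.

Lemma Prob_ge_0 (E : list nat -> bool) : 0 <= Prob p m n E.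
Proof.
  rewrite Prob_lsum. apply Rmult_le_pos; [|left; apply Rinv_0_lt_compat, Z_gt_0].
  apply lsum_ge_0; intros y _. pose proof (wt_ge_0 p p_ge_0 y). destruct (E y); lra.
Qed.

End Measure.

(** * Thresholds and the tilted distribution *)

(** Supplies the maximum that the [epsilon] in [max_nat] selects. *)
Lemma bounded_has_max (P : nat -> Prop) B :
  (forall j, P j -> (j < B)%nat) -> (exists k, P k) ->
  exists k, P k /\ forall j, P j -> (j <= k)%nat.
Proof.
  revert P; induction B as [|B IH]; intros P HB [k Hk].
  - specialize (HB k Hk); lia.
  - destruct (classic (P B)) as [H|H].
    + exists B. split; [assumption|]. intros j Hj; specialize (HB j Hj); lia.
    + apply IH; [|now exists k]. intros j Hj. specialize (HB j Hj).
      assert (j <> B) by (intros ->; contradiction). lia.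
Qed.

(** Convergence to 0 bounds the set of candidates. A fixed [k0 >= L] with [u k0 > 0] belongs to it
    once [n >= 1 / u k0], so the maximum exists and eventually passes every [L]. *)
Lemma max_nat_threshold (u : nat -> R) :
  is_lim_seq u 0 -> (exists K, forall k, (K <= k)%nat -> 0 < u k) ->
  forall L, exists N, forall n, (N <= n)%nat ->
    let k := max_nat (fun k => u k >= 1 / INR n) in
    (L <= k)%nat /\ 1 / INR n <= u k /\ forall j, (k < j)%nat -> u j < 1 / INR n.
Proof.
  intros Hu [K HK] L.
  set (k0 := (L + K)%nat). assert (H0 : 0 < u k0) by (apply HK; unfold k0; lia).
  destruct (INR_eventually_ge (1 + / u k0)) as [N HN].
  exists N; intros n Hn. specialize (HN n Hn).
  assert (Hi : 0 < / u k0) by now apply Rinv_0_lt_compat.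
  assert (Hn0 : 0 < 1 / INR n) by (apply Rdiv_lt_0_compat; lra).
  destruct (is_lim_seq_within u 0 (1 / INR n) Hu Hn0) as [B HB].
  assert (Hk0 : u k0 >= 1 / INR n).
  { apply Rle_ge. unfold Rdiv. rewrite Rmult_1_l, <- (Rinv_inv (u k0)).
    apply Rinv_le_contravar; lra. }
  destruct (epsilon_spec (inhabits 0%nat) (fun k => u k >= 1 / INR n /\
     forall j, u j >= 1 / INR n -> (j <= k)%nat)) as [H1 H2].
  { apply (bounded_has_max (fun k => u k >= 1 / INR n) B); [|now exists k0].
    intros j Hj. destruct (Nat.lt_ge_cases j B) as [H|H]; [assumption|].
    specialize (HB j H). rewrite Rminus_0_r in HB. apply Rabs_lt_between in HB. lra. }
  fold (max_nat (fun k => u k >= 1 / INR n)) in H1, H2. cbv zeta.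
  split; [|split].
  - specialize (H2 k0 Hk0). unfold k0 in H2; lia.
  - lra.
  - intros j Hj. apply Rnot_le_lt; intros H. specialize (H2 j (Rle_ge _ _ H)). lia.
Qed.

(** * Geometric tails and the location of the three thresholds *)

Section Ratio.

Variables (p : nat -> R) (r : R) (K : nat).
Hypothesis p_ge_0 : forall k, 0 <= p k.
Hypothesis p_sum : is_series p 1.
Hypothesis p_pos : forall k, (K <= k)%nat -> 0 < p k.
Hypothesis r_pos : 0 < r < 1.
Hypothesis p_ratio : forall k, (K <= k)%nat -> p (S k) <= r * p k.

Notation T := (tail_sum p).

Lemma tail_sum_pos k : (K <= k)%nat -> 0 < T k.
Proof.
  intros Hk. rewrite tail_sum_S by assumption.
  pose proof (tail_sum_ge_0 p p_ge_0 p_sum (S k)). specialize (p_pos k Hk). lra.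
Qed.

Lemma tail_sum_ratio k : (K <= k)%nat -> T (S k) <= r * T k.
Proof.
  intros Hk. unfold tail_sum. rewrite <- Series_scal_l. apply Series_le.
  - intros l; split; [apply p_ge_0|]. apply (p_ratio (k + l)). lia.
  - exists (r * T k). apply (is_series_scal_l r (fun l => p (k + l)%nat)).
    now apply is_series_tail.
Qed.

Lemma tail_sum_ratio_pow k C : (K <= k)%nat -> T (k + C) <= r ^ C * T k.
Proof.
  intros Hk; induction C as [|C IH]; [rewrite Nat.add_0_r; simpl; lra|].
  rewrite Nat.add_succ_r. pose proof (tail_sum_ratio (k + C) ltac:(lia)). simpl.
  assert (r * T (k + C) <= r * (r ^ C * T k)) by (apply Rmult_le_compat_l; lra). lra.
Qed.

(** Solve [T k = p k + T (S k) <= p k + r * T k] for [T k]. *)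
Lemma tail_sum_le_head k : (K <= k)%nat -> T k <= p k / (1 - r).
Proof.
  intros Hk. pose proof (tail_sum_ratio k Hk). rewrite (tail_sum_S p p_sum k) in *.
  apply Rle_div_r; [lra|]. nra.
Qed.

Lemma tail_sum_lt_head k : (K <= k)%nat -> p k < T k.
Proof. intros Hk. pose proof (tail_sum_pos (S k) ltac:(lia)). rewrite (tail_sum_S p p_sum k). lra. Qed.

(** [x] stands for the number of boxes. One step back from the crossing gains a factor [/ r];
    forward, [p (S k)] is already below [1 / x], the next step gains [r], and passing from [p] to
    its tail costs [1 / (1 - r)]. *)
Lemma bracket_1 (x : R) k :
  0 < x -> (K < k)%nat -> 1 / x <= p k -> p (S k) < 1 / x ->
  1 <= x * T k /\ / r <= x * T (k - 1) /\ x * T (k + 2) <= r / (1 - r).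
Proof.
  intros Hx Hk H1 H2.
  apply Rle_div_l in H1; [|assumption]. apply Rlt_div_r in H2; [|assumption].
  pose proof (tail_sum_lt_head k ltac:(lia)). pose proof (tail_sum_lt_head (k - 1) ltac:(lia)).
  pose proof (p_ratio (k - 1) ltac:(lia)) as R1. pose proof (p_ratio (S k) ltac:(lia)) as R2.
  pose proof (tail_sum_le_head (k + 2) ltac:(lia)) as R3.
  replace (S (k - 1)) with k in R1 by lia. replace (k + 2)%nat with (S (S k)) in * by lia.
  split; [|split].
  - nra.
  - apply Rmult_le_reg_l with r; [lra|]. rewrite Rinv_r by lra.
    assert (x * p k <= x * (r * p (k - 1)%nat)) by (apply Rmult_le_compat_l; lra).
    assert (x * (r * p (k - 1)%nat) <= x * (r * T (k - 1))).
    { apply Rmult_le_compat_l; [lra|]. apply Rmult_le_compat_l; lra. }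
    lra.
  - apply (Rle_div_r _ _ (1 - r)); [lra|]. apply (Rle_div_r _ _ (1 - r)) in R3; [|lra].
    assert (x * (T (S (S k)) * (1 - r)) <= x * (r * p (S k))) by (apply Rmult_le_compat_l; lra).
    assert (r * (p (S k) * x) <= r * 1) by (apply Rmult_le_compat_l; lra).
    lra.
Qed.

Lemma bracket_2 (x : R) k :
  0 < x -> (K < k)%nat -> 1 / x <= T k -> T (S k) < 1 / x ->
  1 <= x * T k /\ / r <= x * T (k - 1) /\ x * T (k + 2) <= r.
Proof.
  intros Hx Hk H1 H2.
  apply Rle_div_l in H1; [|assumption]. apply Rlt_div_r in H2; [|assumption].
  pose proof (tail_sum_ratio (k - 1) ltac:(lia)) as R1. pose proof (tail_sum_ratio (S k) ltac:(lia)) as R2.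
  replace (S (k - 1)) with k in R1 by lia. replace (k + 2)%nat with (S (S k)) in * by lia.
  split; [|split].
  - lra.
  - apply Rmult_le_reg_l with r; [lra|]. rewrite Rinv_r by lra.
    assert (x * T k <= x * (r * T (k - 1))) by (apply Rmult_le_compat_l; lra). lra.
  - assert (x * T (S (S k)) <= x * (r * T (S k))) by (apply Rmult_le_compat_l; lra).
    assert (r * (T (S k) * x) <= r * 1) by (apply Rmult_le_compat_l; lra). lra.
Qed.

(** Where the geometric mean crosses [1 / x], the ratio bound pushes [T k] above and [T (k + 2)]
    below [1 / x] by a factor [sqrt r] each. So the lower end is [k] itself, not [k - 1]. Squares
    avoid the root of [r]. *)
Lemma bracket_3 (x : R) k :
  0 < x -> (K < k)%nat -> 1 / x <= sqrt (T k * T (S k)) -> sqrt (T (S k) * T (S (S k))) < 1 / x ->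
  1 <= r * (x * T k) ^ 2 /\ (x * T (k + 2)) ^ 2 <= r.
Proof.
  intros Hx Hk H1 H2.
  apply Rle_div_l in H1; [|assumption]. apply Rlt_div_r in H2; [|assumption].
  pose proof (tail_sum_ratio k ltac:(lia)) as R1. pose proof (tail_sum_ratio (S k) ltac:(lia)) as R2.
  replace (k + 2)%nat with (S (S k)) in * by lia.
  pose proof (tail_sum_pos k ltac:(lia)) as P0. pose proof (tail_sum_pos (S k) ltac:(lia)) as P1.
  pose proof (tail_sum_pos (S (S k)) ltac:(lia)) as P2.
  assert (Q1 : 0 <= T k * T (S k)) by (apply Rmult_le_pos; lra).
  assert (Q2 : 0 <= T (S k) * T (S (S k))) by (apply Rmult_le_pos; lra).
  pose proof (sqrt_sqrt _ Q1) as S1. pose proof (sqrt_sqrt _ Q2) as S2.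
  pose proof (sqrt_pos (T k * T (S k))). pose proof (sqrt_pos (T (S k) * T (S (S k)))).
  set (s1 := sqrt (T k * T (S k))) in *. set (s2 := sqrt (T (S k) * T (S (S k)))) in *.
  split.
  - apply Rle_trans with ((s1 * x) ^ 2); [nra|].
    replace ((s1 * x) ^ 2) with (x ^ 2 * (s1 * s1)) by ring. rewrite S1.
    replace (r * (x * T k) ^ 2) with (x ^ 2 * (T k * (r * T k))) by ring.
    apply Rmult_le_compat_l; [apply pow2_ge_0|]. apply Rmult_le_compat_l; lra.
  - apply Rle_trans with (r * (s2 * x) ^ 2).
    + replace (r * (s2 * x) ^ 2) with (x ^ 2 * (r * (s2 * s2))) by ring. rewrite S2.
      replace ((x * T (S (S k))) ^ 2) with (x ^ 2 * (T (S (S k)) * T (S (S k)))) by ring.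
      apply Rmult_le_compat_l; [apply pow2_ge_0|].
      rewrite <- Rmult_assoc. apply Rmult_le_compat_r; lra.
    + assert (0 <= s2 * x) by nra. assert ((s2 * x) ^ 2 <= 1) by nra. nra.
Qed.

End Ratio.

(** * Tilting by [tau], and the moments and ratios of the tilted law *)

Lemma wt_pik w tau y m n :
  Phi w tau <> 0 -> In y (comps m n) ->
  wt (pik w tau) y = tau ^ m / Phi w tau ^ n * wt w y.
Proof.
  intros HP. revert y m; induction n as [|n IH]; intros y m Hy.
  - simpl in Hy. destruct m; simpl in Hy; [|contradiction].
    destruct Hy as [<-|[]]. unfold wt; simpl. field.
  - change (In y (flat_map (fun i => map (cons i) (comps (m - i) n)) (seq 0 (S m)))) in Hy.
    apply in_flat_map in Hy. destruct Hy as [i [Hi Hy]]. apply in_seq in Hi.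
    apply in_map_iff in Hy. destruct Hy as [y' [<- Hy']].
    change (pik w tau i * wt (pik w tau) y' = tau ^ m / Phi w tau ^ S n * (w i * wt w y')).
    rewrite (IH _ _ Hy'). unfold pik.
    replace m with (i + (m - i))%nat at 2 by lia. rewrite pow_add. simpl.
    field. split; [now apply pow_nonzero|assumption].
Qed.

(** All configurations have sum [m] and length [n], so tilting multiplies each weight by the same
    [tau ^ m / Phi w tau ^ n], which cancels in the quotient. *)
Lemma Prob_pik w tau m n E :
  0 < tau -> Phi w tau <> 0 -> Prob (pik w tau) m n E = Prob w m n E.
Proof.
  intros Ht HP. set (b := tau ^ m / Phi w tau ^ n).
  assert (Hb : b <> 0).
  { unfold b, Rdiv. apply Rmult_integral_contrapositive_currified.
    - apply pow_nonzero; lra.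
    - now apply Rinv_neq_0_compat, pow_nonzero. }
  assert (HZ : Zmn (pik w tau) m n = b * Zmn w m n).
  { change (lsum (comps m n) (wt (pik w tau)) = b * lsum (comps m n) (wt w)).
    rewrite <- lsum_scal. apply lsum_ext; intros y Hy. now apply wt_pik. }
  assert (HE : lsum (filter E (comps m n)) (wt (pik w tau)) = b * lsum (filter E (comps m n)) (wt w)).
  { rewrite <- lsum_scal. apply lsum_ext; intros y Hy. apply wt_pik; [assumption|].
    apply filter_In in Hy. tauto. }
  change (lsum (filter E (comps m n)) (wt (pik w tau)) / Zmn (pik w tau) m n
    = lsum (filter E (comps m n)) (wt w) / Zmn w m n).
  rewrite HZ, HE. unfold Rdiv. rewrite Rinv_mult.
  replace (b * lsum (filter E (comps m n)) (wt w) * (/ b * / Zmn w m n))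
    with (b * / b * (lsum (filter E (comps m n)) (wt w) * / Zmn w m n)) by ring.
  rewrite Rinv_r by assumption. ring.
Qed.

Section Moments.

Variables (w : nat -> R) (tau : R).
Hypothesis w_ge_0 : forall k, 0 <= w k.
Hypothesis w0_pos : 0 < w 0%nat.
Hypothesis tau_pos : 0 < tau.
Hypothesis tau_lt_rho : Rbar_lt (Finite tau) (rho w).

(** Stated for any [v] with the radius of [w], to serve [w] and its formal derivatives alike. *)
Lemma is_series_PSeries (v : nat -> R) :
  CV_radius v = rho w -> is_series (fun k => v k * tau ^ k) (PSeries v tau).
Proof.
  intros Hv. apply is_pseries_R, PSeries_correct, CV_disk_correct, CV_disk_inside.
  rewrite Hv, Rabs_pos_eq by lra. exact tau_lt_rho.
Qed.

Lemma Phi_pos : 0 < Phi w tau.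
Proof.
  pose proof (psum_le_series _ _ 1 (fun k => Rmult_le_pos _ _ (w_ge_0 k)
    (pow_le tau k (Rlt_le _ _ tau_pos))) (is_series_PSeries w eq_refl)) as H.
  unfold psum, lsum in H. simpl in H. unfold Phi. lra.
Qed.

Lemma pik_ge_0 k : 0 <= pik w tau k.
Proof.
  unfold pik. apply Rdiv_le_0_compat; [|apply Phi_pos].
  apply Rmult_le_pos; [apply pow_le; lra|apply w_ge_0].
Qed.

Lemma is_series_pik : is_series (pik w tau) 1.
Proof.
  pose proof Phi_pos as HP.
  replace 1 with (/ Phi w tau * Phi w tau) by (field; lra).
  apply (is_series_ext (fun k => / Phi w tau * (w k * tau ^ k))).
  - intros k. change (/ Phi w tau * (w k * tau ^ k) = pik w tau k). unfold pik, Rdiv. ring.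
  - apply (is_series_scal_l (/ Phi w tau) (fun k => w k * tau ^ k)).
    now apply is_series_PSeries.
Qed.

Lemma is_series_mean_pik : is_series (fun k => INR k * pik w tau k) (Psi w tau).
Proof.
  pose proof Phi_pos as HP.
  apply is_series_decr_1.
  apply (is_series_ext (fun k => (tau / Phi w tau) * (PS_derive w k * tau ^ k))).
  - intros k. change (tau / Phi w tau * (PS_derive w k * tau ^ k) = INR (S k) * pik w tau (S k)).
    unfold PS_derive, pik. simpl pow. unfold Rdiv. ring.
  - change (is_series (fun k => tau / Phi w tau * (PS_derive w k * tau ^ k))
      (Psi w tau + - (0 * pik w tau 0))).
    replace (Psi w tau + - (0 * pik w tau 0)) with (tau / Phi w tau * PSeries (PS_derive w) tau).
    + apply (is_series_scal_l (tau / Phi w tau) (fun k => PS_derive w k * tau ^ k)).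
      apply is_series_PSeries. apply CV_radius_derive.
    + unfold Psi. unfold Phi at 2. rewrite Derive_PSeries.
      * field; lra.
      * rewrite Rabs_pos_eq by lra. exact tau_lt_rho.
Qed.

(** Since [k^2 <= 2 k (k - 1)] for [k >= 2], the second formal derivative dominates, and it has the
    same radius of convergence. *)
Lemma second_moment_pik : exists V, 0 <= V /\ forall M, psum (fun x => INR x ^ 2 * pik w tau x) M <= V.
Proof.
  pose proof Phi_pos as HP.
  assert (H : ex_series (fun k => INR k ^ 2 * pik w tau k)).
  { apply (ex_series_incr_n _ 2).
    apply (@ex_series_le R_AbsRing R_CompleteNormedModule _ (fun k => 2 * tau ^ 2 / Phi w tau
       * (PS_derive (PS_derive w) k * tau ^ k))).
    - intros k.
      change (Rabs (INR (S (S k)) ^ 2 * pik w tau (S (S k)))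
        <= 2 * tau ^ 2 / Phi w tau * (PS_derive (PS_derive w) k * tau ^ k)).
      rewrite Rabs_pos_eq by (apply Rmult_le_pos; [apply pow2_ge_0|apply pik_ge_0]).
      unfold PS_derive, pik. rewrite !S_INR. pose proof (pos_INR k).
      apply Rle_trans with
        (2 * (INR k + 1) * (INR k + 1 + 1) * (tau ^ S (S k) * w (S (S k)) / Phi w tau)).
      + apply Rmult_le_compat_r; [apply (pik_ge_0 (S (S k)))|]. nra.
      + right. simpl pow. field. lra.
    - exists (2 * tau ^ 2 / Phi w tau * PSeries (PS_derive (PS_derive w)) tau).
      apply (is_series_scal_l _ (fun k => PS_derive (PS_derive w) k * tau ^ k)).
      apply is_series_PSeries. now rewrite !CV_radius_derive. }
  exists (Series (fun k => INR k ^ 2 * pik w tau k)).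
  assert (HM : forall M, psum (fun x => INR x ^ 2 * pik w tau x) M
     <= Series (fun k => INR k ^ 2 * pik w tau k)).
  { intros M. apply psum_le_series; [|now apply Series_correct].
    intros k. apply Rmult_le_pos; [apply pow2_ge_0|apply pik_ge_0]. }
  split; [exact (HM 0%nat)|exact HM].
Qed.

Variable a : R.
Hypothesis w_pos : exists K, forall k, (K <= k)%nat -> 0 < w k.
Hypothesis w_ratio : is_lim_seq (fun k => w (S k) / w k) a.

Lemma ratio_limit_ge_0 : 0 <= a.
Proof.
  destruct w_pos as [K HK].
  apply (is_lim_seq_le_loc (fun _ => 0) (fun k => w (S k) / w k) 0 a);
    [|apply is_lim_seq_const|assumption].
  exists K; intros k Hk. apply Rdiv_le_0_compat; [apply w_ge_0|now apply HK].
Qed.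

(** Otherwise [a t > 1] for some [t] between [tau] and the radius, and [w k * t ^ k] would
    eventually be positive and nondecreasing although its series converges. *)
Lemma ratio_limit_tau_lt_1 : a * tau < 1.
Proof.
  assert (Ht : exists t, tau < t /\ Rbar_lt (Finite t) (rho w)).
  { destruct (rho w) as [x| |]; simpl in *.
    - exists ((tau + x) / 2). lra.
    - exists (tau + 1). split; [lra|exact I].
    - contradiction. }
  destruct Ht as [t [Htau Ht]].
  apply Rnot_le_lt; intros Ha.
  assert (Hat : 0 < a - / t).
  { apply Rmult_lt_reg_r with t; [lra|]. rewrite Rmult_0_l, Rmult_minus_distr_r, Rinv_l by lra.
    assert (0 < a) by (pose proof ratio_limit_ge_0; nra). nra. }
  destruct w_pos as [K HK].
  destruct (is_lim_seq_within _ _ _ w_ratio Hat) as [N HN].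
  assert (Hgrow : forall k, w (K + N)%nat * t ^ (K + N) <= w (K + N + k)%nat * t ^ (K + N + k)).
  { induction k as [|k IH]; [rewrite Nat.add_0_r; lra|].
    apply Rle_trans with (1 := IH). rewrite Nat.add_succ_r.
    set (k' := (K + N + k)%nat).
    specialize (HN k' ltac:(unfold k'; lia)). specialize (HK k' ltac:(unfold k'; lia)).
    apply Rabs_lt_between in HN. assert (H : / t < w (S k') / w k') by lra.
    apply Rlt_div_r in H; [|assumption].
    assert (w k' <= w (S k') * t).
    { apply Rmult_le_reg_l with (/ t); [apply Rinv_0_lt_compat; lra|].
      replace (/ t * (w (S k') * t)) with (w (S k')) by (field; lra). lra. }
    simpl pow. rewrite <- Rmult_assoc. apply Rmult_le_compat_r; [apply pow_le; lra|assumption]. }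
  assert (Hlim : is_lim_seq (fun k => w k * t ^ k) 0).
  { apply ex_series_lim_0. apply ex_pseries_R, CV_disk_correct, CV_disk_inside.
    rewrite Rabs_pos_eq by lra. exact Ht. }
  assert (H0 : 0 < w (K + N)%nat * t ^ (K + N)).
  { apply Rmult_lt_0_compat; [apply HK; lia|apply pow_lt; lra]. }
  destruct (is_lim_seq_within _ _ _ Hlim H0) as [N' HN'].
  specialize (HN' (K + N + N')%nat ltac:(lia)). specialize (Hgrow N').
  rewrite Rminus_0_r in HN'. apply Rabs_lt_between in HN'. lra.
Qed.

(** Successive terms have ratios tending to [a * tau]; for [a = 0] this allows every [r > 0]. *)
Lemma pik_ratio r : a * tau < r -> exists K, forall k, (K <= k)%nat ->
  0 < pik w tau k /\ pik w tau (S k) <= r * pik w tau k.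
Proof.
  intros Hr. pose proof Phi_pos as HP. destruct w_pos as [K HK].
  destruct (is_lim_seq_within _ _ ((r - a * tau) / tau) w_ratio) as [N HN].
  { apply Rdiv_lt_0_compat; lra. }
  exists (K + N)%nat; intros k Hk. specialize (HK k ltac:(lia)). specialize (HN k ltac:(lia)).
  assert (Htk : 0 < tau ^ k) by now apply pow_lt.
  split; [unfold pik; apply Rdiv_lt_0_compat; [now apply Rmult_lt_0_compat|assumption]|].
  apply Rabs_lt_between in HN.
  assert (H : w (S k) / w k <= r / tau).
  { replace (r / tau) with (a + (r - a * tau) / tau) by (field; lra). lra. }
  apply (Rle_div_l _ (r / tau) (w k)) in H; [|assumption].
  unfold pik. simpl pow.
  replace (tau * tau ^ k * w (S k) / Phi w tau) with (tau * tau ^ k / Phi w tau * w (S k))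
    by (field; lra).
  replace (r * (tau ^ k * w k / Phi w tau)) with (tau * tau ^ k / Phi w tau * (r / tau * w k))
    by (field; lra).
  apply Rmult_le_compat_l; [|assumption].
  apply Rdiv_le_0_compat; [apply Rmult_le_pos|]; lra.
Qed.

End Moments.

(** * Order statistics *)

Lemma count_ge_perm k y y' : Permutation y y' -> count_ge k y = count_ge k y'.
Proof.
  intros H; induction H; unfold count_ge in *; simpl;
    repeat (destruct (Nat.leb k _)); simpl; congruence.
Qed.

Lemma count_ge_app k y y' : count_ge k (y ++ y') = (count_ge k y + count_ge k y')%nat.
Proof. unfold count_ge. now rewrite filter_app, length_app. Qed.

Lemma count_ge_le_length k y : (count_ge k y <= length y)%nat.
Proof. unfold count_ge. apply filter_length_le. Qed.

Lemma count_ge_all_lt k y : (forall x, In x y -> (x < k)%nat) -> count_ge k y = 0%nat.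
Proof.
  intros H; induction y as [|x y IH]; [reflexivity|].
  unfold count_ge in *; simpl. destruct (Nat.leb_spec k x) as [Hx|Hx].
  - specialize (H x (or_introl eq_refl)); lia.
  - apply IH. intros x' Hx'; apply H; now right.
Qed.

Lemma StronglySorted_rev_nth_le (l : list nat) i i' :
  StronglySorted le l -> (i <= i')%nat -> (i' < length l)%nat ->
  (nth i' (rev l) 0 <= nth i (rev l) 0)%nat.
Proof.
  intros Hl Hi Hi'. rewrite !rev_nth by lia.
  assert (G : forall l, StronglySorted le l -> forall u v, (u <= v)%nat -> (v < length l)%nat ->
     (nth u l 0 <= nth v l 0)%nat).
  { clear; intros l H; induction H as [|x l H IH Hx]; intros u v Huv Hv; simpl in *; [lia|].
    destruct v as [|v]; [replace u with 0%nat by lia; lia|].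
    destruct u as [|u]; [|apply IH; lia].
    rewrite Forall_forall in Hx. apply Hx, nth_In. lia. }
  apply G; [assumption|lia|lia].
Qed.

Lemma sort_StronglySorted y : StronglySorted le (NatSort.sort y).
Proof.
  assert (L : forall x x', is_true (NatOrder.leb x x') -> (x <= x')%nat).
  { intros x; induction x as [|x IH]; intros [|x'] H; simpl in *; try discriminate; try lia.
    apply IH in H; lia. }
  assert (L' : forall x x', (x <= x')%nat -> is_true (NatOrder.leb x x')).
  { intros x; induction x as [|x IH]; intros [|x'] H; simpl in *; try reflexivity; try lia.
    apply IH; lia. }
  assert (H : StronglySorted (fun x x' => is_true (NatOrder.leb x x')) (NatSort.sort y)).
  { apply NatSort.StronglySorted_sort. intros x x' x'' H1 H2.
    apply L'. apply L in H1. apply L in H2. lia. }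
  induction H as [|x l H IH Hx]; constructor; [assumption|].
  rewrite Forall_forall in *. intros x' Hx'. now apply L, Hx.
Qed.

(** In decreasing order only the first [j - 1] entries can reach [k]. With fewer than [j] boxes
    [order_stat] is the default 0, and the count is below [j] anyway. *)
Lemma order_stat_lt_count j k y :
  (1 <= j)%nat -> (order_stat j y < k)%nat -> (count_ge k y < j)%nat.
Proof.
  intros Hj H. unfold order_stat in H. set (l := NatSort.sort y) in *.
  assert (HP : Permutation y (rev l)).
  { apply perm_trans with l; [apply NatSort.Permuted_sort|apply Permutation_rev]. }
  rewrite (count_ge_perm k _ _ HP), <- (firstn_skipn (j - 1) (rev l)), count_ge_app.
  pose proof (count_ge_le_length k (firstn (j - 1) (rev l))) as H1.
  rewrite length_firstn in H1.
  rewrite (count_ge_all_lt k (skipn _ _)); [lia|].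
  intros x Hx. apply (In_nth _ _ 0%nat) in Hx. destruct Hx as [i [Hi <-]].
  rewrite length_skipn, length_rev in Hi. rewrite nth_skipn.
  pose proof (StronglySorted_rev_nth_le l (j - 1) (j - 1 + i) (sort_StronglySorted y)
    ltac:(lia) ltac:(lia)). lia.
Qed.

(** The assumption [1 <= k] rules out the default value 0, so the order statistic is the content of
    an actual box. *)
Lemma order_stat_ge_count j k y :
  (1 <= k)%nat -> (k <= order_stat j y)%nat -> (1 <= count_ge k y)%nat.
Proof.
  intros Hk H. unfold order_stat in H.
  destruct (nth_in_or_default (j - 1) (rev (NatSort.sort y)) 0%nat) as [Hin|E]; [|lia].
  set (x := nth (j - 1) (rev (NatSort.sort y)) 0%nat) in *.
  apply in_rev in Hin.
  apply (Permutation_in x (Permutation_sym (NatSort.Permuted_sort y))) in Hin.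
  unfold count_ge. assert (Hf : In x (filter (Nat.leb k) y)).
  { apply filter_In. split; [assumption|]. now apply Nat.leb_le. }
  destruct (filter (Nat.leb k) y); [contradiction|simpl; lia].
Qed.

(** * Localisation of an order statistic *)

Lemma is_lim_seq_m_within (m : nat -> nat) lam :
  is_lim_seq (fun n => (INR (m n) - lam * INR n) / sqrt (INR n)) 0 ->
  exists N, forall n, (N <= n)%nat -> Rabs (INR (m n) - lam * INR n) <= sqrt (INR n).
Proof.
  intros H. destruct (is_lim_seq_within _ _ 1 H Rlt_0_1) as [N HN].
  (* [S N] excludes [n = 0], where the quotient divides by zero. *)
  exists (S N); intros n Hn. specialize (HN n ltac:(lia)). rewrite Rminus_0_r in HN.
  assert (Hs : 0 < sqrt (INR n)) by (apply sqrt_lt_R0, lt_0_INR; lia).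
  rewrite Rabs_div, (Rabs_pos_eq (sqrt _)) in HN by lra.
  apply Rlt_div_l in HN; lra.
Qed.

Lemma coin_below p K :
  (forall k, 0 <= p k) -> (forall k, (K <= k)%nat -> 0 < p k) ->
  exists al, 0 < al <= 1 /\ forall x, al * coin K x <= p x.
Proof.
  intros Hp HK.
  pose proof (HK K ltac:(lia)) as H0. pose proof (HK (K + 1)%nat ltac:(lia)) as H1.
  pose proof (HK (K + 2)%nat ltac:(lia)) as H2.
  set (al := Rmin (Rmin (p K) (p (K + 1)%nat)) (Rmin (p (K + 2)%nat) 1)).
  assert (Hal : al <= p K /\ al <= p (K + 1)%nat /\ al <= p (K + 2)%nat /\ al <= 1).
  { unfold al. repeat split; eapply Rle_trans.
    - apply Rmin_l.
    - apply Rmin_l.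
    - apply Rmin_l.
    - apply Rmin_r.
    - apply Rmin_r.
    - apply Rmin_l.
    - apply Rmin_r.
    - apply Rmin_r. }
  assert (Hpos : 0 < al) by (unfold al; repeat apply Rmin_pos; lra).
  exists al. split; [lra|]. intros x. specialize (Hp x). unfold coin.
  destruct (Nat.eqb_spec x K); [subst; destruct (Nat.eqb_spec K (K + 1)); [lia|];
    destruct (Nat.eqb_spec K (K + 2)); [lia|lra]|].
  destruct (Nat.eqb_spec x (K + 1)); [subst; destruct (Nat.eqb_spec (K + 1) (K + 2)); [lia|lra]|].
  destruct (Nat.eqb_spec x (K + 2)); [subst; lra|lra].
Qed.

(** Combines both Chernoff bounds. [A] is fixed before [n], the event, the window and [r], so that
    [r] may later be made small. *)
Lemma order_stat_between p (lam : R) V m K j :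
  (1 <= j)%nat ->
  (forall k, 0 <= p k) -> is_series p 1 -> (forall k, (K <= k)%nat -> 0 < p k) ->
  is_series (fun k => INR k * p k) lam ->
  0 <= V -> (forall M, psum (fun x => INR x ^ 2 * p x) M <= V) ->
  is_lim_seq (fun n => (INR (m n) - lam * INR n) / sqrt (INR n)) 0 ->
  exists A N, 0 < A /\ forall n, (N <= n)%nat -> 0 < Zmn p (m n) n /\
    forall (E : list nat -> bool) lo hi r, (K + 3 <= lo)%nat -> (K + 3 <= hi)%nat -> 0 < r <= 1 ->
    / r <= INR n * tail_sum p lo -> INR n * tail_sum p hi <= r ->
    (forall y, E y = true -> (order_stat j y < lo \/ hi <= order_stat j y)%nat) ->
    Prob p (m n) n E <= A * r.
Proof.
  intros Hj Hp Hsum HK Hmean HV0 HV Hm.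
  destruct (coin_below p K Hp HK) as (al & Hal & Hcoin).
  destruct (Zmn_lower p al K lam V m Hal Hcoin) as (c & N & Hc & HN); try assumption.
  { intros M; now apply psum_le_series. }
  { now apply is_lim_seq_psum. }
  { now apply is_lim_seq_psum. }
  { now apply is_lim_seq_m_within. }
  set (B := 2 / sqrt al / c).
  assert (HB : 0 < B) by (unfold B; repeat apply Rdiv_lt_0_compat; try apply sqrt_lt_R0; lra).
  assert (H2j : 0 < 2 ^ j) by (apply pow_lt; lra).
  exists (B * (2 ^ j * 2 + exp 1)), (S N). pose proof (exp_pos 1).
  split; [apply Rmult_lt_0_compat; nra|]. intros n Hn. specialize (HN n ltac:(lia)).
  assert (Hn1 : (1 <= n)%nat) by lia.
  pose proof (Z_pos p c (m n) n Hc Hn1 HN) as HZ. split; [exact HZ|].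
  intros E lo hi r Hlo Hhi Hr Hr1 Hr2 HE.
  apply Rle_trans with (Prob p (m n) n (fun y => Nat.ltb (order_stat j y) lo
    || Nat.leb hi (order_stat j y))).
  { apply (Prob_le_impl p (m n) n Hp HZ). intros y Hy. apply orb_true_iff.
    rewrite Nat.ltb_lt, Nat.leb_le. auto. }
  apply Rle_trans with (1 := Prob_orb p (m n) n Hp HZ _ _).
  replace (B * (2 ^ j * 2 + exp 1) * r) with (B * 2 ^ j * (2 * r) + B * exp 1 * r) by ring.
  apply Rplus_le_compat.
  - apply Rle_trans with (B * 2 ^ j * exp (- (INR n * tail_sum p lo / 2))).
    + apply (Prob_count_lt p Hp Hsum al K ltac:(lra) Hcoin c (m n) n Hc Hn1 HN); [lia|].
      intros y Hy. apply Nat.ltb_lt in Hy. now apply order_stat_lt_count.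
    + apply Rmult_le_compat_l; [apply Rmult_le_pos; lra|].
      set (x := INR n * tail_sum p lo) in *.
      assert (Hx : 0 < / r) by (apply Rinv_0_lt_compat; lra).
      (* [exp (x / 2) >= 1 + x / 2 >= 1 / (2 r)], so the exponential is at most [2 r]. *)
      rewrite exp_Ropp. pose proof (exp_ineq1_le (x / 2)).
      replace (2 * r) with (/ (/ r / 2)) by (field; lra).
      apply Rinv_le_contravar; lra.
  - assert (Ht : 0 < tail_sum p hi).
    { rewrite (tail_sum_S p Hsum). pose proof (tail_sum_ge_0 p Hp Hsum (S hi)).
      specialize (HK hi ltac:(lia)). lra. }
    apply Rle_trans with (B * exp 1 * (INR n * tail_sum p hi)).
    + apply (Prob_count_ge_1 p Hp Hsum al K ltac:(lra) Hcoin c (m n) n Hc Hn1 HN);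
        [lia| |assumption|lra].
      intros y Hy. apply Nat.leb_le in Hy. apply order_stat_ge_count with j; lia.
    + apply Rmult_le_compat_l; [apply Rmult_le_pos|]; lra.
Qed.

(** [ok] is what tightness uses; the other bounds give the windows [[k - 1, k + 1]] for [k1], [k2]
    and [{k, k + 1}] for [k3] when [r] is small. *)
Lemma thresholds_bracket w tau (p := pik w tau) r K :
  (forall k, 0 <= p k) -> is_series p 1 -> 0 < r < 1 ->
  (forall k, (K <= k)%nat -> 0 < p k /\ p (S k) <= r * p k) ->
  forall L, exists N, forall n, (N <= n)%nat ->
    let ok k := (L <= k)%nat /\ 1 <= INR n * tail_sum p k in
    (ok (k1 w tau n) /\ / r <= INR n * tail_sum p (k1 w tau n - 1)
       /\ INR n * tail_sum p (k1 w tau n + 2) <= r / (1 - r)) /\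
    (ok (k2 w tau n) /\ / r <= INR n * tail_sum p (k2 w tau n - 1)
       /\ INR n * tail_sum p (k2 w tau n + 2) <= r) /\
    (ok (k3 w tau n) /\ 1 <= r * (INR n * tail_sum p (k3 w tau n)) ^ 2
       /\ (INR n * tail_sum p (k3 w tau n + 2)) ^ 2 <= r).
Proof.
  intros Hp Hsum Hr HK L.
  assert (HK1 : forall k, (K <= k)%nat -> 0 < p k) by (intros; now apply HK).
  assert (HK2 : forall k, (K <= k)%nat -> p (S k) <= r * p k) by (intros; now apply HK).
  assert (Hpos : forall k, (K <= k)%nat -> 0 < tail_sum p k).
  { intros; now apply (tail_sum_pos p K). }
  pose proof (tail_sum_lim_0 p Hsum) as Hlim.
  assert (Hlim' : is_lim_seq (fun k => tail_sum p (S k)) 0)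
    by now apply (is_lim_seq_incr_1 (tail_sum p)).
  set (L' := (L + K + 1)%nat).
  destruct (max_nat_threshold p) with (L := L') as [N1 H1].
  { apply ex_series_lim_0. now exists 1. }
  { now exists K. }
  destruct (max_nat_threshold (tail_sum p)) with (L := L') as [N2 H2]; [assumption|now exists K|].
  destruct (max_nat_threshold (fun k => sqrt (tail_sum p k * tail_sum p (S k)))) with (L := L')
    as [N3 H3].
  { replace (Finite 0) with (Finite (sqrt (0 * 0))) by (rewrite Rmult_0_l, sqrt_0; reflexivity).
    apply (is_lim_seq_continuous sqrt); [apply continuity_pt_sqrt; lra|].
    now apply is_lim_seq_mult'. }
  { exists K. intros k Hk. apply sqrt_lt_R0, Rmult_lt_0_compat; apply Hpos; lia. }
  exists (S (N1 + N2 + N3)). intros n Hn ok.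
  assert (Hn0 : 0 < INR n) by (apply lt_0_INR; lia).
  destruct (H1 n ltac:(lia)) as (A1 & B1 & C1). destruct (H2 n ltac:(lia)) as (A2 & B2 & C2).
  destruct (H3 n ltac:(lia)) as (A3 & B3 & C3). unfold L' in *.
  change (max_nat (fun k => p k >= 1 / INR n)) with (k1 w tau n) in *.
  change (max_nat (fun k => tail_sum p k >= 1 / INR n)) with (k2 w tau n) in *.
  change (max_nat (fun k => sqrt (tail_sum p k * tail_sum p (S k)) >= 1 / INR n))
    with (k3 w tau n) in *.
  destruct (bracket_1 p r K Hp Hsum HK1 Hr HK2 (INR n) (k1 w tau n) Hn0 ltac:(lia) B1
    (C1 _ (Nat.lt_succ_diag_r _))) as (D1 & E1 & F1).
  destruct (bracket_2 p r K Hp Hsum Hr HK2 (INR n) (k2 w tau n) Hn0 ltac:(lia) B2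
    (C2 _ (Nat.lt_succ_diag_r _))) as (D2 & E2 & F2).
  destruct (bracket_3 p r K Hp Hsum HK1 Hr HK2 (INR n) (k3 w tau n) Hn0 ltac:(lia) B3
    (C3 _ (Nat.lt_succ_diag_r _))) as (D3 & E3).
  assert (G3 : 1 <= INR n * tail_sum p (k3 w tau n)).
  { specialize (Hpos (k3 w tau n) ltac:(lia)).
    set (x := INR n * tail_sum p (k3 w tau n)) in *.
    assert (Hx : 0 < x) by now apply Rmult_lt_0_compat.
    apply Rnot_lt_le; intros Hx1. assert (x ^ 2 < 1) by (simpl; nra).
    pose proof (pow2_ge_0 x). nra. }
  unfold ok. repeat split; try assumption; lia.
Qed.

(** * Tightness, and concentration for [a = 0] *)

Theorem theorem18p16
  (w : nat -> R) (a lam tau : R) (m : nat -> nat)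
  (Hw_nonneg : forall k, 0 <= w k)
  (Hw0 : 0 < w 0%nat)
  (Hw_large : exists K, forall k, (K <= k)%nat -> 0 < w k)
  (Hratio : is_lim_seq (fun k => w (S k) / w k) (Finite a))
  (Hm : is_lim_seq (fun n => (INR (m n) - lam * INR n) / sqrt (INR n)) 0)
  (Hlam_pos : 0 < lam)
  (Hlam_nu : exists nu : Rbar, is_nu w nu /\ Rbar_lt (Finite lam) nu)
  (Htau_pos : 0 < tau)
  (Htau_rho : Rbar_lt (Finite tau) (rho w))
  (Htau : Psi w tau = lam) :
  (forall j : nat, (1 <= j)%nat ->
     tight_around w m (order_stat j) (k1 w tau) /\
     tight_around w m (order_stat j) (k2 w tau) /\
     tight_around w m (order_stat j) (k3 w tau))
  /\
  (a = 0 ->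
   forall j : nat, (1 <= j)%nat ->
     is_lim_seq
       (fun n => Prob w (m n) n
          (fun y => near_nat (order_stat j y) (k1 w tau n) 1
                    && near_nat (order_stat j y) (k2 w tau n) 1
                    && (Nat.eqb (order_stat j y) (k3 w tau n)
                        || Nat.eqb (order_stat j y) (S (k3 w tau n)))))
       1).
Proof.
  set (p := pik w tau).
  assert (HPhi : Phi w tau <> 0) by (apply Rgt_not_eq, Phi_pos; assumption).
  assert (Hp : forall k, 0 <= p k) by now apply pik_ge_0.
  assert (Hsum : is_series p 1) by now apply is_series_pik.
  assert (Hmean : is_series (fun k => INR k * p k) lam).
  { rewrite <- Htau. now apply is_series_mean_pik. }
  destruct (second_moment_pik w tau Hw_nonneg Hw0 Htau_pos Htau_rho) as (V & HV0 & HV).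
  pose proof (ratio_limit_ge_0 w Hw_nonneg a Hw_large Hratio) as Ha0.
  pose proof (ratio_limit_tau_lt_1 w tau Hw_nonneg Htau_pos Htau_rho a Hw_large Hratio) as Ha1.
  assert (Hrat : forall r, a * tau < r -> exists K, forall k, (K <= k)%nat ->
     0 < p k /\ p (S k) <= r * p k) by now apply pik_ratio.
  split.
  - intros j Hj.
    set (r := (1 + a * tau) / 2). assert (Hr : 0 < r < 1) by (unfold r; nra).
    destruct (Hrat r ltac:(unfold r; lra)) as [K HK].
    assert (HK1 : forall k, (K <= k)%nat -> 0 < p k) by (intros; now apply HK).
    assert (HK2 : forall k, (K <= k)%nat -> p (S k) <= r * p k) by (intros; now apply HK).
    destruct (order_stat_between p lam V m K j Hj Hp Hsum HK1 Hmean HV0 HV Hm)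
      as (A & N & HA & HN).
    (* A criterion for all three thresholds: if [n T] is at least 1 at [kk n] and bounded at
       [kk n + 2], then [C] further steps on either side gain a factor [r ^ C]. *)
    assert (G : forall kk : nat -> nat,
      (forall L, exists N, forall n, (N <= n)%nat -> (L <= kk n)%nat /\
         1 <= INR n * tail_sum p (kk n) /\ INR n * tail_sum p (kk n + 2) <= / (1 - r)) ->
      tight_around w m (order_stat j) kk).
    { intros kk Hkk eps Heps.
      set (B := / (1 - r)). assert (HB : 1 <= B).
      { unfold B. rewrite <- Rinv_1. apply Rinv_le_contravar; lra. }
      destruct (pow_lt_1_zero r ltac:(rewrite Rabs_pos_eq; lra) (Rmin 1 (eps / A) / B)) as [C HC].
      { apply Rdiv_lt_0_compat; [apply Rmin_pos; [lra|now apply Rdiv_lt_0_compat]|lra]. }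
      specialize (HC C (le_n C)). rewrite Rabs_pos_eq in HC by (apply pow_le; lra).
      apply Rlt_div_r in HC; [|lra].
      assert (HrC : 0 < r ^ C) by (apply pow_lt; lra).
      set (d := r ^ C * B) in *. assert (Hd : 0 < d) by (apply Rmult_lt_0_compat; lra).
      pose proof (Rmin_l 1 (eps / A)). pose proof (Rmin_r 1 (eps / A)).
      (* This level keeps the subtraction [kk n - C] exact and its value at least [K + 3]. *)
      destruct (Hkk (K + 3 + C)%nat) as [N' HN'].
      exists (C + 2)%nat, (S (N + N')). intros n Hn.
      destruct (HN' n ltac:(lia)) as (H1 & H2 & H3). destruct (HN n ltac:(lia)) as [_ Hb].
      assert (Hn0 : 0 < INR n) by (apply lt_0_INR; lia).
      rewrite <- (Prob_pik w tau) by assumption. fold p.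
      apply Rle_trans with (A * d).
      - apply (Hb _ (kk n - C)%nat (kk n + 2 + C)%nat); [lia|lia|lra| | |].
        + pose proof (tail_sum_ratio_pow p r K Hp Hsum Hr HK2 (kk n - C) C ltac:(lia)) as T1.
          replace (kk n - C + C)%nat with (kk n) in T1 by lia.
          apply Rmult_le_reg_l with d; [assumption|]. rewrite Rinv_r by lra.
          apply Rmult_le_compat_l with (r := INR n) in T1; [|lra].
          assert (T2 : 1 <= r ^ C * (INR n * tail_sum p (kk n - C))) by lra.
          unfold d. nra.
        + pose proof (tail_sum_ratio_pow p r K Hp Hsum Hr HK2 (kk n + 2) C ltac:(lia)) as T1.
          apply Rmult_le_compat_l with (r := INR n) in T1; [|lra].
          apply Rmult_le_compat_l with (r := r ^ C) in H3; [|lra].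
          unfold d, B. lra.
        + intros y Hy. apply negb_true_iff in Hy. unfold near_nat in Hy.
          apply andb_false_iff in Hy. rewrite !Nat.leb_gt in Hy. lia.
      - apply Rle_trans with (A * (eps / A)); [apply Rmult_le_compat_l; lra|].
        right. field. lra. }
    assert (Hr2 : r <= / (1 - r) /\ r / (1 - r) <= / (1 - r)).
    { assert (1 <= / (1 - r)) by (rewrite <- Rinv_1; apply Rinv_le_contravar; lra).
      split; [lra|]. unfold Rdiv. nra. }
    pose proof (thresholds_bracket w tau r K Hp Hsum Hr HK) as Hth.
    split; [|split]; apply G; intros L; destruct (Hth L) as [N' HN']; exists (S N'); intros n Hn;
      destruct (HN' n ltac:(lia)) as
        (((L1 & B1) & _ & C1) & ((L2 & B2) & _ & C2) & ((L3 & B3) & _ & C3)); fold p in B1, B2, B3, C1, C2, C3.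
    + repeat split; [assumption..|lra].
    + repeat split; [assumption..|lra].
    + repeat split; [assumption..|].
      assert (1 <= / (1 - r)) by (rewrite <- Rinv_1; apply Rinv_le_contravar; lra).
      nra.
  - intros Ha j Hj.
    (* The ratio 1/2 serves to fix [K] and [A] before [eps]; the small ratio [r] gets its own [K']
       below. *)
    destruct (Hrat (1/2) ltac:(rewrite Ha; lra)) as [K HK].
    assert (HK1 : forall k, (K <= k)%nat -> 0 < p k) by (intros; now apply HK).
    destruct (order_stat_between p lam V m K j Hj Hp Hsum HK1 Hmean HV0 HV Hm)
      as (A & N & HA & HN).
    apply is_lim_seq_spec. intros eps.
    set (d := Rmin 1 (eps / (2 * A))).
    assert (Hd : 0 < d <= 1).
    { split; [|apply Rmin_l]. apply Rmin_pos; [lra|].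
      apply Rdiv_lt_0_compat; [apply cond_pos|lra]. }
    assert (Hd2 : A * d < eps).
    { pose proof (cond_pos eps).
      apply Rle_lt_trans with (A * (eps / (2 * A))).
      - apply Rmult_le_compat_l; [lra|apply Rmin_r].
      - replace (A * (eps / (2 * A))) with (eps / 2) by (field; lra). lra. }
    (* [sqrt r = d / 2] turns the squared bounds at [k3] into bounds in terms of [d]; the bounds [r]
       and [r / (1 - r)] at [k2] and [k1] are below [d] too. *)
    set (r := d ^ 2 / 4). assert (Hr : 0 < r < 1) by (unfold r; nra).
    assert (Hrd : r / (1 - r) <= d).
    { apply (Rle_div_l _ _ (1 - r)); [lra|]. unfold r; nra. }
    assert (Hrd' : r <= d) by (unfold r; nra).
    assert (Hir : / d <= / r) by (apply Rinv_le_contravar; lra).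
    destruct (Hrat r ltac:(rewrite Ha; lra)) as [K' HK'].
    (* The level [K + 4] leaves [q1 - 1] and [q2 - 1] at least [K + 3]. *)
    destruct (thresholds_bracket w tau r K' Hp Hsum Hr HK' (K + 4)) as [N' HN'].
    exists (S (N + N')). intros n Hn.
    destruct (HN' n ltac:(lia)) as
      (((L1 & _) & B1 & C1) & ((L2 & _) & B2 & C2) & ((L3 & D3) & B3 & C3)).
    destruct (HN n ltac:(lia)) as [HZ Hb].
    assert (Hn0 : 0 < INR n) by (apply lt_0_INR; lia).
    fold p in B1, B2, B3, C1, C2, C3, D3.
    set (q1 := k1 w tau n) in *. set (q2 := k2 w tau n) in *. set (q3 := k3 w tau n) in *.
    assert (B3' : / d <= INR n * tail_sum p q3).
    { set (x := INR n * tail_sum p q3) in *.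
      apply Rmult_le_reg_l with d; [lra|]. rewrite Rinv_r by lra.
      assert (4 <= (d * x) ^ 2) by (unfold r in B3; nra).
      assert (0 <= d * x) by (apply Rmult_le_pos; lra). nra. }
    assert (C3' : INR n * tail_sum p (q3 + 2) <= d).
    { set (x := INR n * tail_sum p (q3 + 2)) in *. unfold r in C3. nra. }
    (* The intersection of the three windows: the tail bounds hold at every end, hence at the
       largest lower and the smallest upper one, and a single use of [Hb] treats the joint event. *)
    set (lo := Nat.max (q1 - 1) (Nat.max (q2 - 1) q3)).
    set (hi := Nat.min (q1 + 2) (Nat.min (q2 + 2) (q3 + 2))).
    rewrite <- (Prob_pik w tau) by assumption. fold p.
    rewrite (Prob_negb p (m n) n HZ).
    set (P := Prob p (m n) n _).
    assert (HP : 0 <= P) by now apply Prob_ge_0.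
    assert (HP' : P <= A * d).
    { apply (Hb _ lo hi d); [unfold lo; lia|unfold hi; lia|assumption| | |].
      - destruct (Nat.max_spec (q2 - 1) q3) as [[_ E]|[_ E]];
          destruct (Nat.max_spec (q1 - 1) (Nat.max (q2 - 1) q3)) as [[_ E']|[_ E']];
          unfold lo; rewrite E', ?E; lra.
      - destruct (Nat.min_spec (q2 + 2) (q3 + 2)) as [[_ E]|[_ E]];
          destruct (Nat.min_spec (q1 + 2) (Nat.min (q2 + 2) (q3 + 2))) as [[_ E']|[_ E']];
          unfold hi; rewrite E', ?E; lra.
      - intros y Hy. apply negb_true_iff in Hy. unfold near_nat in Hy.
        rewrite !andb_false_iff, orb_false_iff, !Nat.leb_gt, !Nat.eqb_neq in Hy.
        unfold lo, hi. lia. }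
    apply Rabs_lt_between. lra.
Qed.
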